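(* Let $m,n\ge 2$ be integers with $(m-1)(n-1)>1$, and consider the free product $C_m*C_n$ of finite cyclic groups of orders $m$ and $n$, with the natural generating set consisting of one generator of $C_m$ and one generator of $C_n$. Let $p_c$ be the critical probability of Bernoulli bond percolation on the corresponding Cayley graph and $h(C_m*C_n)$ the Cheeger constant of this Cayley graph. Then $$\frac13<p_c<\frac{1}{h(C_m*C_n)+1}.$$
   Context: Cayley graph: for a group $G$ with finite generating set $S$, the graph has vertex set $G$ and, for each pair $(g,s)\in G\times S$, one edge joining $g$ and $gs$ (edges counted with multiplicity); in particular a generator of order $2$ gives two parallel edges, and the Cayley graph of $C_m$ with its single generator is a cycle of length $m$ (a double edge if $m=2$). The origin $o$ is the identity element. Bernoulli bond percolation with parameter $p\in[0,1]$: each edge is independently open with probability $p$ and closed otherwise, with product measure $\mathrm{P}_p$. $C$ is the connected component of $o$ in the random subgraph of open edges, $|C|$ its number of vertices, $\theta(p)=\mathrm{P}_p(|C|=\infty)$, and $p_c=\inf\{p\in[0,1]:\theta(p)>0\}$. Cheeger constant of a graph with vertex set $V$ and edge set $E$: $h=\inf_K\frac{|\partial K|}{|K|}$, the infimum over finite non-empty $K\subset V$, where $\partial K$ is the set of edges (with multiplicity) having exactly one endpoint in $K$. *)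

(* Defs.v *)
From HB Require Import structures.
From mathcomp Require Import all_boot all_order all_algebra all_fingroup.
From mathcomp Require Import all_solvable finmap.
From mathcomp Require Import all_classical all_reals all_analysis.
From mathcomp Require Import measurable_realfun lra.

Set Implicit Arguments.
Unset Strict Implicit.
Unset Printing Implicit Defensive.

Import Order.TTheory GRing.Theory Num.Theory.

Local Open Scope classical_set_scope.
Local Open Scope ring_scope.

(** The elements of [G1 * G2] are the reduced words: sequences of non-identity
    letters taken alternately from [G1] and from [G2]. *)
Section FreeProductWords.
Variables G1 G2 : groupType.
Local Open Scope group_scope.

Definition letter : Type := (G1 + G2)%type.
Implicit Types (x y : letter) (u v w : seq letter).

Definition nontrivial_letter x : bool :=
  match x with inl a => a != 1 | inr b => b != 1 end.

Definition same_factor x y : bool :=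
  match x, y with inl _, inl _ | inr _, inr _ => true | _, _ => false end.

Definition reduced w : bool :=
  all nontrivial_letter w && sorted (fun x y => ~~ same_factor x y) w.

(** The reduced form of [x :: w], for a reduced word [w] *)
Definition prepend x w : seq letter :=
  if ~~ nontrivial_letter x then w else
  match x, w with
  | inl a, inl a' :: w' => if a * a' == 1 then w' else inl (a * a') :: w'
  | inr b, inr b' :: w' => if b * b' == 1 then w' else inr (b * b') :: w'
  | _, _ => x :: w
  end.

Definition letter_inv x : letter :=
  match x with inl a => inl a^-1 | inr b => inr b^-1 end.

Definition word_mul u v := foldr prepend v u.
Definition word_inv u := rev (map letter_inv u).

Lemma reduced_cons x w : reduced (x :: w) ->
  [/\ nontrivial_letter x, reduced w &
      if w is y :: _ then ~~ same_factor x y else true].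
Proof.
rewrite /reduced; case: w => [|y w] /=; first by rewrite !andbT => ->.
by case/andP=> /and3P[-> -> ->] /andP[-> ->].
Qed.

Lemma prepend_reduced x w : reduced w -> reduced (prepend x w).
Proof.
move=> rw; rewrite /prepend; case: ifP => // /negbFE nx.
case: w rw => [|y w] rw; first by case: x nx => /= ? nx; rewrite /reduced /= nx.
have [ny rw' yw] := reduced_cons rw.
case: x y nx ny rw yw => [a|b] [a'|b'] /= nx ny rw yw; last 1 first.
- case: eqP => // /eqP nab; move: rw' yw; rewrite /reduced.
  by case: w {rw} => [|[c|c] w] /=; rewrite ?nab // => /andP[/andP[-> ->] ->].
- case: eqP => // /eqP nab; move: rw' yw; rewrite /reduced.
  by case: w {rw} => [|[c|c] w] /=; rewrite ?nab // => /andP[/andP[-> ->] ->].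
- by move: rw; rewrite /reduced /= nx => /andP[-> ->].
- by move: rw; rewrite /reduced /= nx => /andP[-> ->].
Qed.

Lemma prepend_id x w : reduced (x :: w) -> prepend x w = x :: w.
Proof.
case/reduced_cons=> nx _ xw; rewrite /prepend nx /=.
by case: x w nx xw => [a|b] [|[c|c] w].
Qed.

Lemma prependMl (a a' : G1) w : reduced w ->
  prepend (inl a) (prepend (inl a') w) = prepend (inl (a * a')) w.
Proof.
move=> rw; rewrite /prepend /=.
case: (eqVneq a' 1) => [->|na'] /=; first by rewrite mulg1.
case: (eqVneq a 1) => [->|na] /=; first by rewrite mul1g na'.
case: w rw => [|[c|c] w] /= rw.
- by case: eqP.
- have /reduced_cons[/= nc _ cw] := rw.
  rewrite -mulgA; case: (eqVneq (a' * c) 1) => [e|ne] /=.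
    have -> : a' = c^-1 by apply: (mulIg c); rewrite mulVg.
    case: (eqVneq (a * c^-1) 1) => [e'|ne'] /=.
      have -> : a = c by apply: (mulIg c^-1); rewrite mulgV.
      by case: w cw {rw} => [|[?|?] ?].
    by rewrite mulVg mulg1 (negPf na); case: w cw {rw} => [|[?|?] ?].
  case: (eqVneq (a * a') 1) => [e|ne'] /=; last by [].
  by rewrite mulgA e mul1g (negPf nc).
- by case: eqP.
Qed.

Lemma prependMr (b b' : G2) w : reduced w ->
  prepend (inr b) (prepend (inr b') w) = prepend (inr (b * b')) w.
Proof.
move=> rw; rewrite /prepend /=.
case: (eqVneq b' 1) => [->|nb'] /=; first by rewrite mulg1.
case: (eqVneq b 1) => [->|nb] /=; first by rewrite mul1g nb'.
case: w rw => [|[c|c] w] /= rw.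
- by case: eqP.
- by case: eqP.
- have /reduced_cons[/= nc _ cw] := rw.
  rewrite -mulgA; case: (eqVneq (b' * c) 1) => [e|ne] /=.
    have -> : b' = c^-1 by apply: (mulIg c); rewrite mulVg.
    case: (eqVneq (b * c^-1) 1) => [e'|ne'] /=.
      have -> : b = c by apply: (mulIg c^-1); rewrite mulgV.
      by case: w cw {rw} => [|[?|?] ?].
    by rewrite mulVg mulg1 (negPf nb); case: w cw {rw} => [|[?|?] ?].
  case: (eqVneq (b * b') 1) => [e|ne'] /=; last by [].
  by rewrite mulgA e mul1g (negPf nc).
Qed.

Lemma word_mul_reduced u v : reduced v -> reduced (word_mul u v).
Proof. by move=> rv; elim: u => //= x u; exact: prepend_reduced. Qed.

Lemma word_mul_prepend x u v : reduced v ->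
  word_mul (prepend x u) v = prepend x (word_mul u v).
Proof.
move=> rv; have rz w : reduced (word_mul w v) by exact: word_mul_reduced.
have prep1 y w : ~~ nontrivial_letter y -> prepend y w = w.
  by move=> ny; rewrite /prepend ny.
case: (boolP (nontrivial_letter x)) => nx; last by rewrite !prep1.
rewrite {1}/prepend nx /=.
case: x u nx => [a|b] [|[c|c] u] nx //=.
  by rewrite prependMl //; case: eqP => // ->; rewrite prep1 //= eqxx.
by rewrite prependMr //; case: eqP => // ->; rewrite prep1 //= eqxx.
Qed.

Lemma word_mulA u v w : reduced w ->
  word_mul u (word_mul v w) = word_mul (word_mul u v) w.
Proof. by move=> rw; elim: u => //= x u ->; rewrite word_mul_prepend. Qed.

Lemma word_mul1 u : reduced u -> word_mul u [::] = u.
Proof.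
elim: u => //= x u IH rxu; have [_ ru _] := reduced_cons rxu.
by rewrite IH // prepend_id.
Qed.

Lemma word_inv_reduced u : reduced u -> reduced (word_inv u).
Proof.
rewrite /reduced /word_inv all_rev all_map rev_sorted sorted_map.
case/andP=> nu su.
apply/andP; split.
  by apply: sub_all nu => -[a|b] /=; rewrite invg_eq1.
by apply: sub_sorted su => -[a|b] [c|c].
Qed.

Lemma word_invK u : word_inv (word_inv u) = u.
Proof.
rewrite /word_inv map_rev revK -map_comp map_id_in // => x _ /=.
by case: x => ? /=; rewrite invgK.
Qed.

Lemma word_mulV u : reduced u -> word_mul (word_inv u) u = [::].
Proof.
elim: u => // x u IH rxu; have [nx ru _] := reduced_cons rxu.
rewrite /word_inv /= rev_cons /word_mul foldr_rcons -(prepend_id rxu).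
rewrite (_ : prepend (letter_inv x) _ = u); first exact: IH.
case: x nx {rxu} => a nx /=.
  by rewrite prependMl // mulVg /prepend /= eqxx.
by rewrite prependMr // mulVg /prepend /= eqxx.
Qed.

End FreeProductWords.

Section FreeProduct.
Variables G1 G2 : groupType.

Record free_product : Type := FreeProduct {
  fp_word :> seq (G1 + G2)%type;
  fp_reduced : reduced fp_word }.

HB.instance Definition _ := [isSub for fp_word].
HB.instance Definition _ := [Choice of free_product by <:].

Definition fp_one : free_product := @FreeProduct [::] isT.

Definition fp_mul (g h : free_product) : free_product :=
  FreeProduct (word_mul_reduced g (fp_reduced h)).

Definition fp_inv (g : free_product) : free_product :=
  FreeProduct (word_inv_reduced (fp_reduced g)).

Lemma fp_mulA : associative fp_mul.
Proof. by move=> f g h; apply/val_inj/word_mulA/fp_reduced. Qed.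

Lemma fp_mul1g : left_id fp_one fp_mul.
Proof. by move=> g; exact/val_inj. Qed.

Lemma fp_mulg1 : right_id fp_one fp_mul.
Proof. by move=> g; apply/val_inj/word_mul1/fp_reduced. Qed.

Lemma fp_mulVg : left_inverse fp_one fp_inv fp_mul.
Proof. by move=> g; apply/val_inj/word_mulV/fp_reduced. Qed.

Lemma fp_mulgV : right_inverse fp_one fp_inv fp_mul.
Proof.
move=> g; apply/val_inj; rewrite /= -[X in word_mul X _]word_invK.
exact/word_mulV/word_inv_reduced/fp_reduced.
Qed.

HB.instance Definition _ :=
  isGroup.Build free_product fp_mulA fp_mul1g fp_mulg1 fp_mulVg fp_mulgV.

Definition fp_inl (a : G1) : free_product :=
  FreeProduct (prepend_reduced (inl a) (isT : reduced [::])).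

Definition fp_inr (b : G2) : free_product :=
  FreeProduct (prepend_reduced (inr b) (isT : reduced [::])).

End FreeProduct.
Arguments fp_inl {G1 G2}.
Arguments fp_inr {G1 G2}.

Record multigraph : Type := Multigraph {
  vertex : choiceType;
  edge : choiceType;
  ends : edge -> vertex * vertex }.

(** One edge per pair [(g, s)]: a generator of order 2 yields two parallel
    edges. *)
Definition cayley (G : groupType) (S : {fset G}) : multigraph :=
  {| vertex := G;
     edge := (G * S)%type;
     ends := fun e : G * S => (e.1, (e.1 * val e.2)%g) |}.

Definition edge_boundary (X : multigraph) (K : {fset vertex X}) :
    set (edge X) :=
  [set e | ((ends e).1 \in K) (+) ((ends e).2 \in K)].

(** [fset_set] counts correctly because the graphs considered are locally
    finite, so that [edge_boundary K] is finite; see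
    [cayley_edge_boundary_finite]. *)
Definition cheeger (R : realType) (X : multigraph) : R :=
  inf [set #|` fset_set (edge_boundary K)|%:R / #|` K|%:R
      | K in [set K : {fset vertex X} | K != fset0]].

Lemma cayley_edge_boundary_finite (G : groupType) (S : {fset G})
    (K : {fset vertex (cayley S)}) :
  finite_set (edge_boundary K).
Proof.
have fin : finite_set ([set` K] `*` [set: S]).
  by apply: finite_setX; [exact: finite_fset | exact: finite_finset].
suff sub : (edge_boundary K : set (G * S)) `<=` [set` K] `*` [set: S] `|`
    (fun q : G * S => ((q.1 * (val q.2)^-1)%g, q.2)) @`
      ([set` K] `*` [set: S]).
  by apply: (sub_finite_set sub); rewrite finite_setU; split => //;
    exact: finite_image.
move=> [g s]; rewrite /edge_boundary /=.
have [gK _|gK /= gsK] := boolP (g \in K); first by left.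
by right; exists ((g * val s)%g, s) => //=; rewrite mulgK.
Qed.

Section Percolation.
Variables (R : realType) (X : multigraph).

(** Configurations [edge X -> bool] ([true] for open) with the product
    sigma-algebra, generated by the events "[e] is open". *)
Definition open_events : set (set (edge X -> bool)) :=
  [set [set w : edge X -> bool | w e] | e in [set: edge X]].

Definition config := g_sigma_algebraType open_events.
HB.instance Definition _ := Measurable.on config.

(** [P] is the product of the Bernoulli([p]) laws over the edges. *)
Definition is_bernoulli_percolation (p : R) (P : probability config R) : Prop :=
  forall (D : {fset edge X}) (c : edge X -> bool),
    P [set w | forall e, e \in D -> w e = c e] =
    (\prod_(e <- D) (if c e then p else 1 - p))%:E.

Definition open_adj (w : config) (x y : vertex X) : bool :=
  `[< exists e, w e /\ (ends e = (x, y) \/ ends e = (y, x)) >].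

Definition cluster (w : config) (o : vertex X) : set (vertex X) :=
  [set x | exists2 q, path (open_adj w) o q & last o q = x].

Definition theta (o : vertex X) (P : probability config R) : \bar R :=
  P [set w | infinite_set (cluster w o)].

(** [P p] stands for the percolation measure with parameter [p]. *)
Definition critical_probability (o : vertex X) (P : R -> probability config R) :
    R :=
  inf [set p : R | 0 <= p <= 1 /\ (0 < theta o (P p))%E].

End Percolation.
Arguments critical_probability {R} X o P.

Section ProbabilityOfMeasure.
Context d (T : measurableType d) (R : realType).
Variable mu : {measure set T -> \bar R}.
Hypothesis mu1 : mu setT = 1%E.

Let nu (A : set T) : \bar R := mu A.
Let nu0 : nu set0 = 0%E. Proof. exact: measure0. Qed.
Let nu_ge0 A : (0 <= nu A)%E. Proof. exact: measure_ge0. Qed.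
Let nu_sigma : semi_sigma_additive nu.
Proof. exact: measure_semi_sigma_additive. Qed.
HB.instance Definition _ := isMeasure.Build _ _ _ nu nu0 nu_ge0 nu_sigma.
HB.instance Definition _ := Measure_isProbability.Build _ _ _ nu mu1.

Lemma probability_of_measure : exists P : probability T R, forall A, P A = mu A.
Proof. by exists nu. Qed.

End ProbabilityOfMeasure.

(** Iterating [shift p], the digits [x < p] of a uniform [x] in [[0, 1[] are
    independent Bernoulli([p]) variables. *)
Section BernoulliPercolationExists.
Variables (R : realType) (p : R).
Hypothesis p01 : 0 <= p <= 1.

Let weight (b : bool) : R := if b then p else 1 - p.
Let shift (x : R) : R := if x < p then x / p else (x - p) / (1 - p).
Let digit (k : nat) (x : R) : bool := iter k shift x < p.

Let measurable_digit k : measurable [set x : R | digit k x].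
Proof.
have mshift : measurable_fun [set: R] shift.
  apply: measurable_fun_ifT => //=.
  - by apply: measurable_fun_ltr.
  - by apply: measurable_funM.
  - by apply: measurable_funM => //; exact: measurable_funB.
have miter : measurable_fun [set: R] (iter k shift).
  elim: k => [|k IH]; first exact: measurable_id.
  exact: measurableT_comp mshift IH.
rewrite (_ : [set x | _] = [set: R] `&` iter k shift @^-1` `]-oo, p[%classic).
  by apply: miter => //; exact: measurable_itv.
by apply/seteqP; split => x /=; rewrite ?in_itv /=; tauto.
Qed.

Let matches (s : seq (option bool)) : set R :=
  [set x | 0 <= x < 1 /\
     forall k b, nth None s k = Some b -> digit k x = b].

Let pattern_weight (s : seq (option bool)) : R :=
  \prod_(o <- s) oapp weight 1 o.

Let matches_itv (s : seq bool) : exists2 l : R, 0 <= l /\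
    l + pattern_weight (map Some s) <= 1 &
    matches (map Some s) = `[l, l + pattern_weight (map Some s)[%classic.
Proof.
have /andP[p0 p1] := p01.
rewrite /pattern_weight; elim: s => [|b s [l [l0 l1] IH]] /=.
  exists 0; rewrite big_nil add0r //.
  apply/seteqP; split => x /=; rewrite in_itv /=; first by case.
  by move=> x01; split => // k b; rewrite nth_nil.
rewrite big_cons /=; set q := \prod_(_ <- _) _ in l1 IH *.
have q0 : 0 <= q.
  rewrite /q big_map; apply: prodr_ge0 => c _ /=; rewrite /weight; case: c; lra.
have step x : matches (Some b :: map Some s) x <->
    (x < p) = b /\ 0 <= x < 1 /\ matches (map Some s) (shift x).
  split.
    move=> [x01 H]; have xb : (x < p) = b by exact: (H 0%N).
    split=> //; split=> //; split.
      rewrite /shift; case/andP: x01 => x0 x1; case: ltP => xp.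
        by rewrite divr_ge0 // ltr_pdivrMr ?mul1r ?xp //; lra.
      by rewrite divr_ge0 ?ltr_pdivrMr; lra.
    by move=> k c Hk; have := H k.+1 c Hk; rewrite /digit iterSr.
  move=> [xb [x01 [_ H]]]; split => // -[|k] c /=; first by case=> <-.
  by move=> Hk; rewrite /digit iterSr; exact: H.
case: b step => step /=.
  exists (p * l).
    split; first by rewrite mulr_ge0.
    by rewrite -mulrDr; nra.
  apply/seteqP; split => x /=; rewrite in_itv /=.
    move/step => [xp [/andP[x0 x1]]]; rewrite IH /= in_itv /= /shift xp.
    have pp : 0 < p by lra.
    by rewrite ler_pdivlMr // ltr_pdivrMr // -mulrDr ![_ * p]mulrC.
  move=> /andP[lx xl]; have xp : x < p by nra.
  have pp : 0 < p by nra.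
  apply/step; rewrite xp; split=> //; split; first by nra.
  rewrite IH /= in_itv /= /shift xp.
  by rewrite ler_pdivlMr // ltr_pdivrMr // ![_ * p]mulrC mulrDr lx xl.
exists (p + (1 - p) * l).
  by split; nra.
apply/seteqP; split => x /=; rewrite in_itv /=.
  move/step => [xp [/andP[x0 x1]]]; rewrite IH /= in_itv /= /shift xp.
  have {xp}/negbT := xp; rewrite -leNgt => xp.
  have pp : 0 < 1 - p by lra.
  by rewrite ler_pdivlMr // ltr_pdivrMr // => /andP[? ?]; apply/andP; split; nra.
move=> /andP[lx xl].
have pp : 0 < 1 - p by nra.
have xp : (x < p) = false by apply/negbTE; rewrite -leNgt; nra.
apply/step; rewrite xp; split=> //; split; first by apply/andP; split; nra.
rewrite IH /= in_itv /= /shift xp.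
by rewrite ler_pdivlMr // ltr_pdivrMr //; apply/andP; split; nra.
Qed.

Let measurable_matches s : measurable (matches s).
Proof.
rewrite (_ : matches s = `[0, 1[%classic `&`
    \bigcap_(k in [set: nat])
      [set x | forall b, nth None s k = Some b -> digit k x = b]).
  apply: measurableI; first exact: measurable_itv.
  apply: bigcapT_measurable => k; case: (nth None s k) => [[]|].
  - rewrite (_ : [set x | _] = [set x | digit k x]) //.
    by apply/seteqP; split => x /= => [/(_ _ erefl)|xk b [<-]].
  - rewrite (_ : [set x | _] = ~` [set x | digit k x]).
      exact: measurableC.
    apply/seteqP; split => x /= => [/(_ _ erefl) ->//|xk b [<-]].
    exact/negbTE/negP.
  - by rewrite (_ : [set x | _] = setT) //; apply/seteqP; split.
apply/seteqP; split => x /=.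
  by case=> x01 H; split; [rewrite in_itv | move=> k _ b /=; exact: H].
by rewrite in_itv /= => -[x01 H]; split => // k b; exact: (H k I).
Qed.

Let lebesgue_matches (s1 : seq bool) (s2 : seq (option bool)) :
  lebesgue_measure (matches (map Some s1 ++ s2)) =
  (pattern_weight (map Some s1) * pattern_weight s2)%:E.
Proof.
have /andP[p0 p1] := p01.
have pw_rcons s b : pattern_weight (map Some (rcons s b)) =
    pattern_weight (map Some s) * weight b.
  by rewrite /pattern_weight map_rcons -cats1 big_cat big_seq1.
have pw0 s : 0 <= pattern_weight (map Some s).
  rewrite /pattern_weight big_map; apply: prodr_ge0 => c _ /=.
  by rewrite /weight; case: c; lra.
elim: s2 s1 => [|[b|] s2 IH] s1.
- rewrite cats0 /pattern_weight big_nil mulr1.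
  have [l _ ->] := matches_itv s1; rewrite lebesgue_measure_itv /= lte_fin.
  case: ltP => [_|]; first by rewrite -EFinB addrC addKr.
  by rewrite gerDl => le0; congr EFin; apply/esym/le_anti; rewrite le0 pw0.
- by rewrite -cat_rcons -map_rcons IH pw_rcons -mulrA /pattern_weight big_cons.
- have E : matches (map Some s1 ++ None :: s2) =
      matches (map Some (rcons s1 true) ++ s2) `|`
      matches (map Some (rcons s1 false) ++ s2).
    rewrite !map_rcons !cat_rcons; apply/seteqP; split => x /=.
      move=> [x01 H].
      suff Hb : matches (map Some s1 ++ Some (digit (size s1) x) :: s2) x.
        by case: (digit _ x) Hb => Hb; [left|right].
      split=> // k b; have := H k b; rewrite !nth_cat size_map.
      case: ltnP => // sk; case: (eqVneq k (size s1)) => [->|nk].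
        by rewrite subnn /= => _ [].
      by rewrite -(subnSK (_ : size s1 < k)%N) // ltn_neqAle eq_sym nk.
    have sub b : matches (map Some s1 ++ Some b :: s2) x ->
        matches (map Some s1 ++ None :: s2) x.
      move=> [x01 H]; split=> // k c; have := H k c; rewrite !nth_cat size_map.
      case: ltnP => // sk; case: (eqVneq k (size s1)) => [->|nk].
        by rewrite subnn.
      by rewrite -(subnSK (_ : size s1 < k)%N) // ltn_neqAle eq_sym nk.
    by case=> /sub.
  rewrite E measureU; try exact: measurable_matches; last first.
    rewrite !map_rcons !cat_rcons -subset0 => x [[_ Ht] [_ Hf]].
    have := Hf (size s1) false; rewrite (Ht (size s1) true).
      by rewrite nth_cat size_map ltnn subnn => /(_ erefl).
    by rewrite nth_cat size_map ltnn subnn.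
  transitivity
    ((pattern_weight (map Some (rcons s1 true)) * pattern_weight s2)%:E
     + (pattern_weight (map Some (rcons s1 false)) * pattern_weight s2)%:E)%E.
    by congr (_ + _)%E; exact: IH.
  have -> : pattern_weight (None :: s2) = pattern_weight s2.
    by rewrite /pattern_weight big_cons /= mul1r.
  by rewrite !pw_rcons -EFinD -mulrDl -mulrDr /weight addrC subrK mulr1.
Qed.

Lemma bernoulli_percolation_exists (X : multigraph) :
  countable [set: edge X] ->
  exists P : probability (config X) R, is_bernoulli_percolation p P.
Proof.
move=> /countable_injP[f finj'].
have finj : injective f by move=> x y; apply: finj'; rewrite in_setT.
pose sample (x : R) : config X := fun e => digit (f e) x.
pose unif := mrestr (@lebesgue_measure R) (measurable_itv `[(0:R), 1[).
have msample : measurable_fun [set: R] sample.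
  apply: (@measurability _ _ (measurableTypeR R) (config X) setT sample
    (@open_events X) erefl) => _ [_ [e _ <-] <-]; rewrite setTI.
  exact: measurable_digit.
pose mu : {measure set (config X) -> \bar R} :=
  measure_function_pushforward__canonical__measure_function_Measure unif msample.
have PT : mu setT = 1%E.
  rewrite /= /pushforward preimage_setT /unif /mrestr setTI.
  by rewrite lebesgue_measure_itv /= lte_fin ltr01 oppr0 adde0.
have [P PE] := probability_of_measure PT; exists P => D c.
pose s := mkseq (fun k => omap c (ohead [seq e <- D | f e == k]))
  (\max_(e <- D) f e).+1.
have sN e : e \in D -> (f e < (\max_(e <- D) f e).+1)%N.
  by move=> eD; rewrite ltnS (bigD1_seq e) ?leq_maxl.
have fil e : e \in D -> [seq e' <- D | f e' == f e] = [:: e].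
  move=> eD; rewrite (eq_filter (a2 := pred1 e)) ?filter_pred1_uniq //.
  by move=> e' /=; exact: inj_eq.
rewrite PE; have -> : mu [set w | forall e, e \in D -> w e = c e] =
    lebesgue_measure (matches s).
  rewrite /= /pushforward /unif /mrestr; congr (lebesgue_measure _).
  apply/seteqP; split => x /=; rewrite in_itv /=.
    move=> [H x01]; split => // k b.
    case: (ltnP k (\max_(e <- D) f e).+1) => kN; last first.
      by rewrite nth_default // size_mkseq.
    rewrite nth_mkseq //.
    case E: [seq e <- D | f e == k] => [//|e t] /= [<-].
    have: e \in [seq e <- D | f e == k] by rewrite E mem_head.
    by rewrite mem_filter => /andP[/eqP <- /H].
  move=> [x01 H]; split=> // e eD; apply: H.
  by rewrite nth_mkseq ?sN // fil.
rewrite -[s]cat0s -[X in X ++ _]/(map Some [::]) lebesgue_matches.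
rewrite /pattern_weight big_nil mul1r; congr EFin.
rewrite /s /mkseq big_map -[iota _ _]/(index_iota 0 (\max_(e <- D) f e).+1).
transitivity (\prod_(e <- D)
    \prod_(0 <= k < (\max_(e <- D) f e).+1 | f e == k) weight (c e)); last first.
  apply: eq_big_seq => e eD.
  rewrite (eq_bigl (fun k => k == f e)); last by move=> k; rewrite eq_sym.
  by rewrite big_nat1_eq /= sN.
rewrite (exchange_big_dep xpredT) //=; apply: eq_bigr => k _.
rewrite -big_filter.
case E: [seq e <- D | f e == k] => [|e t] /=; first by rewrite big_nil.
have : e \in [seq e <- D | f e == k] by rewrite E mem_head.
rewrite mem_filter => /andP[/eqP fe eD].
by have := fil e eD; rewrite fe E => -[->]; rewrite big_seq1.
Qed.
End BernoulliPercolationExists.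

Lemma cayley_bernoulli_percolation_exists (R : realType)
    (G1 G2 : finGroupType) (S : {fset free_product G1 G2}) (p : R) :
  0 <= p <= 1 ->
  exists P : probability (config (cayley S)) R, is_bernoulli_percolation p P.
Proof.
move=> p01; apply: bernoulli_percolation_exists => //.
apply/countable_injP.
pose words : countType := (seq (G1 + G2) * seq (G1 + G2))%type.
exists (fun e : free_product G1 G2 * S =>
  @choice.pickle words (fp_word e.1, fp_word (val e.2))).
move=> [g s] [h t] _ _ /(pcan_inj choice.pickleK) [/val_inj -> st].
by congr pair; apply/val_inj/val_inj.
Qed.

(* Main.v *)
(* The Cayley graph is a tree of cycles of lengths m and n, so the open cluster
   of the origin is a two-type branching process, whose generations are the
   words of a given length.  A vertex of a cycle of length d is joined inside it
   to f_d(p) = sum_(0 < k < d) (p^k + p^(d-k) - p^d) further vertices on average.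
   If f_m(p) f_n(p) < 1, the probability of reaching words of length 2j is at
   most (f_m f_n)^j and theta(p) = 0; if f_m(p) f_n(p) > 1, a second-order
   Bonferroni bound shows that it stays away from 0 and theta(p) > 0.
   As f_d(1/3) < 1 for every d, p_c > 1/3.  For m <= n, the set of all words
   a^i b^j a^k has boundary ratio at most 2 - 2n / (1 + m (n-1)), an upper bound
   on the Cheeger constant, and f_m f_n > 1 already holds at some p below the
   corresponding value of 1 / (h + 1). *)

Require Import Defs.
From mathcomp Require Import all_boot all_order all_algebra all_fingroup.
From mathcomp Require Import all_solvable finmap.
From mathcomp Require Import all_classical all_reals all_analysis.
From mathcomp Require Import zify ring lra.

Import Order.TTheory GRing.Theory Num.Theory.
Local Open Scope ring_scope.

Set Implicit Arguments.
Unset Strict Implicit.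
Unset Printing Implicit Defensive.

(** * Events depending on finitely many edges *)

Section LocalEvents.
Local Open Scope classical_set_scope.
Context (R : realType) (X : multigraph) (p : R).
Implicit Types (w : edge X -> bool) (s : seq (edge X)).

Definition switch w (e : edge X) (b : bool) : edge X -> bool :=
  fun e' => if e' == e then b else w e'.

(** [T] is [bool] for events and [R] for the factors pulled out of an [average]; [s] may contain
    more edges than matter. *)
Definition determined {T : Type} s (f : (edge X -> bool) -> T) : Prop :=
  forall w w', {in s, w =1 w'} -> f w = f w'.

Lemma determined_sub T s s' (f : _ -> T) :
  {subset s <= s'} -> determined s f -> determined s' f.
Proof. by move=> ss' df w w' ww'; apply: df => e /ss' /ww'. Qed.

Lemma determined_and s (A B : _ -> bool) :
  determined s A -> determined s B -> determined s (fun w => A w && B w).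
Proof. by move=> dA dB w w' ww'; rewrite (dA w w') // (dB w w'). Qed.

(* The expectation of [f] when the edges of [s] are resampled and the other
   ones keep their state in [w]. *)
Fixpoint average s (f : (edge X -> bool) -> R) w : R :=
  if s is e :: s' then
    p * average s' f (switch w e true) + (1 - p) * average s' f (switch w e false)
  else f w.

Lemma average_cat s s' f w :
  average (s ++ s') f w = average s (average s' f) w.
Proof. by elim: s w => //= e s IH w; rewrite !IH. Qed.

Lemma eq_average s f g w : f =1 g -> average s f w = average s g w.
Proof. by move=> fg; elim: s w => //= e s IH w; rewrite !IH. Qed.

Lemma averageD s f g w :
  average s (fun w => f w + g w) w = average s f w + average s g w.
Proof. by elim: s w => //= e s IH w; rewrite !IH; ring. Qed.

Lemma averageZ s c f w : average s (fun w => c * f w) w = c * average s f w.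
Proof. by elim: s w => //= e s IH w; rewrite !IH; ring. Qed.

Lemma average_sum s (I : Type) (r : seq I) (F : I -> _ -> R) w :
  average s (fun w => \sum_(i <- r) F i w) w = \sum_(i <- r) average s (F i) w.
Proof.
elim: r => [|i r IH].
  rewrite big_nil -[RHS](mul0r (average s (fun=> 0) w)) -averageZ.
  by apply: eq_average => w'; rewrite big_nil mul0r.
rewrite big_cons -IH -averageD; apply: eq_average => w'.
by rewrite big_cons.
Qed.

Lemma average_le s f g w : 0 <= p <= 1 ->
  (forall w, f w <= g w) -> average s f w <= average s g w.
Proof.
move=> /andP[p0 p1] fg; elim: s w => //= e s IH w.
by apply: lerD; apply: ler_wpM2l => //; rewrite subr_ge0.
Qed.

(** Resampling [s] never touches the edges on which [f] depends. The independence of disjoint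
    regions rests on this. *)
Lemma average_mull s s' f g w : determined s' f -> {in s, forall e, e \notin s'} ->
  average s (fun w => f w * g w) w = f w * average s g w.
Proof.
move=> df; elim: s w => //= e s IH w ess'.
have esw b : f (switch w e b) = f w.
  apply: df => e' e's'; rewrite /switch; case: eqP => // ee'.
  by move: (ess' e); rewrite mem_head -ee' e's' => /(_ isT).
rewrite !IH ?esw; first by ring.
all: by move=> e' e's; apply: ess'; rewrite in_cons e's orbT.
Qed.

Lemma average_map (tau : edge X -> edge X) s f w : injective tau ->
  average (map tau s) (fun w => f (w \o tau)) w = average s f (w \o tau).
Proof.
move=> injt; elim: s w => //= e s IH w; rewrite !IH.
have sw b : switch w (tau e) b \o tau = switch (w \o tau) e b.
  by apply/funext => e'; rewrite /switch /= (inj_eq injt).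
by rewrite !sw.
Qed.

(** * Probabilities of local events as finite averages *)

Variable P : probability (config X) R.

Definition prob (A : (edge X -> bool) -> bool) : R :=
  fine (P [set w : config X | A w]).

Hypothesis bP : is_bernoulli_percolation p P.

Lemma measurable_edge (e : edge X) b :
  measurable [set w : config X | w e = b].
Proof.
have mt : measurable [set w : config X | w e].
  by apply: sub_sigma_algebra; exists e.
case: b => //; rewrite (_ : [set w | _] = ~` [set w : config X | w e])%classic.
  exact: measurableC.
by apply/seteqP; split => w /=; case: (w e).
Qed.

(** Splitting on the state of the first edge of [s] moves that edge into [D]. Once [s] is exhausted,
    [A] is constant on the cylinder, so the event is either the whole cylinder, of known measure, or
    empty. *)
Let cylinder_average s (D : {fset edge X}) c (A : _ -> bool) :
  uniq s -> {in s, forall e, e \notin D} -> determined (D ++ s) A ->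
  let E := [set w : config X | (forall e, e \in D -> w e = c e) /\ A w] in
  measurable E /\
  P E = ((\prod_(e <- D) (if c e then p else 1 - p)) *
         average s (fun w => (A w)%:R) c)%:E.
Proof.
elim: s D c => [|e s IH] D c us dis dA /=.
  have mD : measurable
      [set w : config X | forall e, e \in D -> w e = c e].
    rewrite (_ : mkset _ = \bigcap_(e in [set` D])
      [set w : config X | w e = c e])%classic; last first.
      by apply/seteqP; split => w /=.
    apply: fin_bigcap_measurable => // e _; exact: measurable_edge.
  have AE w : (forall e, e \in D -> w e = c e) -> A w = A c.
    by move=> wc; apply: dA => e; rewrite cats0; exact: wc.
  case Ac: (A c); last first.
    rewrite (_ : mkset _ = set0)%classic ?mulr0 ?measure0 //.
    by apply/seteqP; split => w //= [/AE ->]; rewrite Ac.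
  rewrite (_ : mkset _ = [set w : config X | forall e, e \in D -> w e = c e]).
    by rewrite mulr1 bP.
  by apply/seteqP; split => w //= => [[]//|wc]; split=> //; rewrite (AE _ wc).
have /andP[es us'] := us.
have eD : e \notin D by apply: dis; rewrite mem_head.
pose E b := [set w : config X |
  (forall e', e' \in (e |` D)%fset -> w e' = switch c e b e') /\ A w].
have dis' : {in s, forall e', e' \notin (e |` D)%fset}.
  move=> e' e's; rewrite in_fset1U negb_or dis ?in_cons ?e's ?orbT // andbT.
  by apply: contraNneq es => <-.
have dA' : determined ((e |` D)%fset ++ s) A.
  apply: determined_sub dA => e'; rewrite !mem_cat in_fset1U in_cons.
  by case/or3P => ->; rewrite ?orbT.
have [mt Pt] := IH (e |` D)%fset (switch c e true) us' dis' dA'.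
have [mf Pf] := IH (e |` D)%fset (switch c e false) us' dis' dA'.
have ED b : forall w, (forall e', e' \in (e |` D)%fset -> w e' = switch c e b e')
    <-> w e = b /\ (forall e', e' \in D -> w e' = c e').
  move=> w; split=> [H|[we H] e'].
    split=> [|e' e'D]; first by rewrite H ?fset1U1 // /switch eqxx.
    rewrite H ?fset1Ur // /switch; case: eqP => // e'e.
    by rewrite -e'e e'D in eD.
  rewrite /switch in_fset1U; case: eqP => [->//|_] /=; exact: H.
have EP b w : E b w <-> w e = b /\ (forall e', e' \in D -> w e' = c e') /\ A w.
  split=> [[wD Aw]|[we [wD Aw]]]; last by split=> //; apply/ED.
  by have [] := (ED b w).1 wD.
have -> : [set w : config X | (forall e', e' \in D -> w e' = c e') /\ A w] =
    E true `|` E false.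
  apply/seteqP; split => w /= => [[wD Aw]|[|] /EP[_ []] //].
  by case we: (w e); [left|right]; apply/EP; split.
split; first exact: measurableU.
have EI : E true `&` E false = set0.
  by apply/seteqP; split => w //= -[/EP[we _] /EP[]]; rewrite we.
transitivity (P (E true) + P (E false))%E; first exact: measureU.
have prodE b : \prod_(e' <- (e |` D)%fset)
    (if switch c e b e' then p else 1 - p) =
    (if b then p else 1 - p) * \prod_(e' <- D) (if c e' then p else 1 - p).
  rewrite big_fsetU1 // /= {1}/switch eqxx; congr (_ * _).
  apply: eq_big_seq => e' e'D; rewrite /switch; case: eqP => // e'e.
  by rewrite -e'e e'D in eD.
rewrite [X in (X + _)%E]Pt [X in (_ + X)%E]Pf -EFinD !prodE /=.
by congr EFin; ring.
Qed.

(** With this, identities and inequalities between probabilities reduce to pointwise ones between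
    indicators. *)
Lemma probP s (A : _ -> bool) w : uniq s -> determined s A ->
  [/\ measurable [set w : config X | A w],
      P [set w : config X | A w] = (prob A)%:E &
      average s (fun w => (A w)%:R) w = prob A].
Proof.
move=> us dA.
have dA0 : determined (fset0 ++ s) A.
  by apply: determined_sub dA => e es; rewrite mem_cat es orbT.
have sD : {in s, forall e, e \notin (fset0 : {fset edge X})} by [].
have /= := cylinder_average w us sD dA0.
rewrite (_ : mkset _ = [set w : config X | A w]); last first.
  by apply/seteqP; split => w' //= -[].
rewrite big_seq_fset0 mul1r => -[mA PA].
by rewrite /prob PA; split.
Qed.

Hypothesis p01 : 0 <= p <= 1.

Lemma prob_ge0 A : 0 <= prob A.
Proof. by rewrite /prob fine_ge0. Qed.

Lemma prob_true : prob xpredT = 1.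
Proof.
by have [_ _ <-] := @probP [::] xpredT (fun=> true) isT (fun _ _ _ => erefl).
Qed.

Lemma prob_indep s s' (A B : _ -> bool) :
  determined s A -> determined s' B -> {in s, forall e, e \notin s'} ->
  prob (fun w => A w && B w) = prob A * prob B.
Proof.
move=> dA dB ss'; pose w0 (_ : edge X) := true.
have dA' : determined (undup s) A by apply: determined_sub dA => e; rewrite mem_undup.
have dB' : determined (undup s') B by apply: determined_sub dB => e; rewrite mem_undup.
have dis : {in undup s', forall e, e \notin undup s}.
  move=> e; rewrite !mem_undup => es'.
  by apply/negP => /ss'; rewrite es'.
have usc : uniq (undup s ++ undup s').
  rewrite cat_uniq !undup_uniq andbT /=.
  by apply/hasPn => e /dis.
have [|_ _ <-] := @probP _ (fun w => A w && B w) w0 usc.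
  apply: determined_and.
    by apply: determined_sub dA' => e; rewrite mem_cat => ->.
  by apply: determined_sub dB' => e; rewrite mem_cat orbC => ->.
rewrite average_cat.
transitivity (average (undup s) (fun w => prob B * (A w)%:R) w0).
  apply: eq_average => w.
  rewrite (_ : average _ _ w =
      average (undup s') (fun w => (A w)%:R * (B w)%:R) w); last first.
    by apply: eq_average => w'; rewrite -natrM mulnb.
  rewrite (@average_mull _ (undup s)) //; last first.
    by move=> w1 w2 /dA' ->.
  by have [_ _ ->] := probP w (undup_uniq s') dB'; rewrite mulrC.
by rewrite averageZ mulrC; have [_ _ ->] := probP w0 (undup_uniq s) dA'.
Qed.

Lemma prob_map (tau : edge X -> edge X) s (A : _ -> bool) : injective tau ->
  determined s A -> prob (fun w => A (w \o tau)) = prob A.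
Proof.
move=> injt dA; pose w0 (_ : edge X) := true.
have dA' : determined (undup s) A by apply: determined_sub dA => e; rewrite mem_undup.
have us := undup_uniq s; have [_ _ <-] := probP (w0 \o tau) us dA'.
have [||_ _ <-] := @probP (map tau (undup s)) (fun w => A (w \o tau)) w0.
- by rewrite map_inj_uniq.
- by move=> w w' ww'; apply: dA' => e es /=; apply: ww'; rewrite map_f.
by rewrite -(average_map _ _ _ injt).
Qed.

Lemma prob_le s (A B : _ -> bool) : determined s A -> determined s B ->
  (forall w, A w -> B w) -> prob A <= prob B.
Proof.
move=> dA dB AB; pose w0 (_ : edge X) := true.
have su : {subset s <= undup s} by move=> e; rewrite mem_undup.
have [_ _ <-] := probP w0 (undup_uniq s) (determined_sub su dA).
have [_ _ <-] := probP w0 (undup_uniq s) (determined_sub su dB).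
by apply: average_le => // w; rewrite ler_nat; case: (A w) (AB w) => // ->.
Qed.

Lemma prob_or s (A B : _ -> bool) : determined s A -> determined s B ->
  prob (fun w => A w || B w) = prob A + prob B - prob (fun w => A w && B w).
Proof.
move=> dA dB; pose w0 (_ : edge X) := true.
have su : {subset s <= undup s} by move=> e; rewrite mem_undup.
have us := undup_uniq s.
have dor : determined s (fun w => A w || B w).
  by move=> w w' ww'; rewrite (dA w w') // (dB w w').
have [_ _ <-] := probP w0 us (determined_sub su dor).
have [_ _ <-] := probP w0 us (determined_sub su dA).
have [_ _ <-] := probP w0 us (determined_sub su dB).
have [_ _ <-] := probP w0 us (determined_sub su (determined_and dA dB)).
rewrite -averageD -[X in _ - X]mul1r -mulNr -averageZ -averageD.
by apply: eq_average => w; case: (A w); case: (B w) => /=; ring.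
Qed.

Let sum_count (I : Type) (r : seq I) (a : pred I) :
  \sum_(i <- r) (a i)%:R = (count a r)%:R :> R.
Proof. by elim: r => [|i r IH]; rewrite ?big_nil // big_cons IH /= natrD. Qed.

(** Union bound: pointwise, the indicator of a union is at most the number of events that occur. *)
Lemma prob_has s (I : eqType) (r : seq I) (A : I -> _ -> bool) :
  {in r, forall i, determined s (A i)} ->
  prob (fun w => has (A ^~ w) r) <= \sum_(i <- r) prob (A i).
Proof.
move=> dA; pose w0 (_ : edge X) := true.
have su : {subset s <= undup s} by move=> e; rewrite mem_undup.
have dh : determined s (fun w => has (A ^~ w) r).
  by move=> w w' ww'; apply: eq_in_has => i ir; apply: dA.
have [_ _ <-] := probP w0 (undup_uniq s) (determined_sub su dh).
have -> : \sum_(i <- r) prob (A i) =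
    average (undup s) (fun w => \sum_(i <- r) (A i w)%:R) w0.
  rewrite average_sum; apply: eq_big_seq => i ir.
  by have [_ _ ->] := probP w0 (undup_uniq s) (determined_sub su (dA _ ir)).
apply: average_le => // w; rewrite sum_count ler_nat has_count.
by case: (count _ _).
Qed.

(** Bonferroni over ordered pairs: if [N] of the events occur, then [N - N * (N - 1)] is at most the
    indicator of [N > 0], with equality for [N <= 1]. *)
Lemma prob_has_ge s (I : eqType) (r : seq I) (A : I -> _ -> bool) :
  uniq r -> {in r, forall i, determined s (A i)} ->
  \sum_(i <- r) prob (A i) -
    \sum_(i <- r) \sum_(j <- r | j != i) prob (fun w => A i w && A j w) <=
  prob (fun w => has (A ^~ w) r).
Proof.
move=> ur dA; pose w0 (_ : edge X) := true.
have su : {subset s <= undup s} by move=> e; rewrite mem_undup.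
have us := undup_uniq s.
have dh : determined s (fun w => has (A ^~ w) r).
  by move=> w w' ww'; apply: eq_in_has => i ir; apply: dA.
have [_ _ <-] := probP w0 us (determined_sub su dh).
pose N w := \sum_(i <- r) (A i w)%:R : R.
have EN : \sum_(i <- r) prob (A i) = average (undup s) N w0.
  rewrite average_sum; apply: eq_big_seq => i ir.
  by have [_ _ ->] := probP w0 us (determined_sub su (dA _ ir)).
have EN2 : \sum_(i <- r) \sum_(j <- r | j != i) prob (fun w => A i w && A j w) =
    average (undup s) (fun w => N w ^+ 2 + (- 1) * N w) w0.
  rewrite averageD averageZ -EN mulN1r.
  rewrite (_ : average _ _ w0 = average (undup s) (fun w =>
    \sum_(i <- r) \sum_(j <- r) (A i w && A j w)%:R) w0); last first.
    apply: eq_average => w; rewrite expr2 /N mulr_suml; apply: eq_bigr => i _.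
    by rewrite mulr_sumr; apply: eq_bigr => j _; rewrite -natrM mulnb.
  rewrite average_sum -sumrB; apply: eq_big_seq => i ir.
  rewrite average_sum (bigD1_seq i) //= [X in _ = X + _ - _](_ : _ = prob (A i)).
    rewrite addrAC subrr add0r big_seq_cond [RHS]big_seq_cond.
    apply: eq_bigr => j /andP[jr _].
    have [_ _ <-//] := probP w0 us (determined_sub su
      (determined_and (dA _ ir) (dA _ jr))).
  have [_ _ <-] := probP w0 us (determined_sub su (dA _ ir)).
  by apply: eq_average => w; rewrite andbb.
rewrite EN EN2 (_ : _ - _ = average (undup s)
    (fun w => N w + (- 1) * (N w ^+ 2 + (- 1) * N w)) w0); last first.
  by rewrite averageD averageZ mulN1r.
apply: average_le => // w.
have -> : N w = (count (A ^~ w) r)%:R.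
  exact: sum_count.
rewrite has_count; case: (count _ _) => [|[|k]] /=; try lra.
have : (0 : R) <= k%:R by [].
rewrite -[k.+2%:R]/(k.+2%:R) -addn2 natrD; nra.
Qed.

Lemma prob_all_open s : uniq s -> prob (fun w => all w s) = p ^+ size s.
Proof.
move=> us; rewrite /prob.
rewrite (_ : mkset _ = [set w : config X | forall e,
  e \in [fset e in s]%fset -> w e = true]).
  rewrite (bP [fset e in s]%fset xpredT) /=.
  rewrite big_const_seq count_predT iter_mulr mulr1; congr (_ ^+ _).
  by apply: perm_size; apply: uniq_perm => // e; rewrite inE.
apply/seteqP; split => w /=; first by move/allP => H e; rewrite inE => /H.
by move=> H; apply/allP => e es; apply: H; rewrite inE.
Qed.

End LocalEvents.

(** * The branching structure of the free product *)

Section FreeProductPercolation.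
Local Open Scope classical_set_scope.
Context (G1 G2 : finGroupType) (a : G1) (b : G2).
Let G := free_product G1 G2.
Let X := cayley [fset (fp_inl a : G); (fp_inr b : G)]%fset.
Implicit Types (t : bool) (g h : G) (w : edge X -> bool) (ks : seq nat).

Lemma fp_inlM : {morph (fp_inl : G1 -> G) : x y / (x * y)%g}.
Proof.
move=> x y; apply/val_inj => /=.
by rewrite word_mul_prepend; [exact/esym/prependMl | exact: prepend_reduced].
Qed.

Lemma fp_inrM : {morph (fp_inr : G2 -> G) : x y / (x * y)%g}.
Proof.
move=> x y; apply/val_inj => /=.
by rewrite word_mul_prepend; [exact/esym/prependMr | exact: prepend_reduced].
Qed.

Lemma fp_inl1 : fp_inl 1%g = 1%g :> G.
Proof. by apply/val_inj; rewrite /= /prepend /= eqxx. Qed.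

Lemma fp_inr1 : fp_inr 1%g = 1%g :> G.
Proof. by apply/val_inj; rewrite /= /prepend /= eqxx. Qed.

(** Booleans name the factors, [false] for [G1] and [true] for [G2], so that [~~ t] is the other
    factor and both vertex types are treated at once. *)
Definition gen t : G := if t then fp_inr b else fp_inl a.
Definition period t : nat := if t then #[b]%g else #[a]%g.

Definition letter_power t (k : nat) : letter G1 G2 :=
  if t then inr (b ^+ k)%g else inl (a ^+ k)%g.

Definition starts t (h : G) : bool :=
  if fp_word h is x :: _ then (if x is inr _ then t else ~~ t) else false.

Lemma genX t k : (gen t ^+ k)%g =
  if t then fp_inr (b ^+ k)%g else fp_inl (a ^+ k)%g.
Proof.
elim: k => [|k IH]; first by case: t; rewrite expg0 ?fp_inr1 ?fp_inl1.
by rewrite expgS IH; case: t {IH}; rewrite ?fp_inrM ?fp_inlM -/(gen _) expgS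
  ?fp_inrM ?fp_inlM.
Qed.

Lemma gen_period t : (gen t ^+ period t)%g = 1%g.
Proof.
by rewrite genX /period; case: t; rewrite expg_order ?fp_inl1 ?fp_inr1.
Qed.

Lemma nontrivial_letter_power t k : (0 < k < period t)%N ->
  nontrivial_letter (letter_power t k).
Proof.
by case/andP=> k0; rewrite /period; case: t => /= kd;
  rewrite -order_dvdn gtnNdvd.
Qed.

(** Nothing cancels in front of a word that does not start in factor [t]. This is the tree structure
    behind all disjointness statements below. *)
Lemma gen_mul_word t k h : (0 < k < period t)%N -> ~~ starts t h ->
  fp_word (gen t ^+ k * h)%g = letter_power t k :: fp_word h.
Proof.
move=> kd th; have nk := nontrivial_letter_power kd.
rewrite genX; have rh := fp_reduced h.
transitivity (prepend (letter_power t k) (fp_word h)).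
  by case: t {th kd nk} => /=; rewrite word_mul_prepend.
move: th nk; rewrite /starts /prepend.
by case: t {kd} => /=; case: (fp_word h) => [|[c|c] u] //= _ ->.
Qed.

Lemma letter_power_inj t k l : (k < period t)%N -> (l < period t)%N ->
  letter_power t k = letter_power t l -> k = l.
Proof.
rewrite /period /letter_power.
by case: t => kd ld [/eqP]; rewrite eq_expg_mod_order !modn_small // => /eqP.
Qed.

Lemma gen_in t : gen t \in [fset (fp_inl a : G); (fp_inr b : G)]%fset.
Proof. by case: t; rewrite !inE eqxx ?orbT. Qed.

Definition edge_at t g : edge X := (g, [` gen_in t]%fset).

Lemma edge_atE (e : edge X) : exists t, e = edge_at t e.1.
Proof.
case: e => g [s sS]; have := sS; rewrite !inE => /orP[] /eqP es.
  by exists false; congr pair; apply/val_inj.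
by exists true; congr pair; apply/val_inj.
Qed.

Definition arc t g i k : seq (edge X) :=
  [seq edge_at t (g * gen t ^+ j)%g | j <- iota i k].

(* The vertices [g] and [g * gen t ^+ k] are joined by an open path inside the
   cycle [g * <[gen t]>]; such a path is one of the two arcs. *)
Definition joined t g k w : bool :=
  all w (arc t g 0 k) || all w (arc t g k (period t - k)).

Definition steps t : seq nat := iota 1 (period t).-1.

Lemma mem_steps t k : (k \in steps t) = (0 < k < period t)%N.
Proof.
rewrite mem_iota add1n; case: (period t) => [|d] //=; by case: k.
Qed.

(** The branching process from [g], entering first the cycle of type [t], has a non-empty generation
    [j]. Cycle types alternate and [k = 0] is excluded, so each generation adds a letter. *)
Fixpoint survives j t g w : bool :=
  if j is j'.+1 then
    has (fun k => joined t g k w && survives j' (~~ t) (g * gen t ^+ k)%g w)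
      (steps t)
  else true.

Fixpoint support j t g : seq (edge X) :=
  if j is j'.+1 then
    arc t g 0 (period t) ++
    flatten [seq support j' (~~ t) (g * gen t ^+ k)%g | k <- steps t]
  else [::].

(** Left multiplication is an automorphism of the Cayley graph; it carries the branch at the
    identity to the branch at [g]. *)
Definition translate g (e : edge X) : edge X := ((g * e.1)%g, e.2).

Lemma translate_inj g : injective (translate g).
Proof.
move=> [x s] [y s'] E; have /mulgI xy : (g * x = g * y)%g := congr1 fst E.
by rewrite xy (congr1 snd E : s = s').
Qed.

Lemma arc_mul t g h i k : arc t (g * h)%g i k = map (translate g) (arc t h i k).
Proof. by rewrite -map_comp; apply: eq_map => j /=; rewrite /translate /= mulgA. Qed.

Lemma joined_mul t g h k w :
  joined t (g * h)%g k w = joined t h k (w \o translate g).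
Proof. by rewrite /joined !arc_mul !all_map. Qed.

Lemma survives_mul j t g h w :
  survives j t (g * h)%g w = survives j t h (w \o translate g).
Proof.
elim: j t h => //= j IH t h; apply: eq_has => k.
by rewrite joined_mul -mulgA IH.
Qed.

Lemma support_mul j t g h : support j t (g * h)%g = map (translate g) (support j t h).
Proof.
elim: j t h => //= j IH t h; rewrite map_cat arc_mul map_flatten -map_comp.
by congr (_ ++ flatten _); apply: eq_map => k /=; rewrite -mulgA IH.
Qed.

Lemma determined_arc t g i k : determined (arc t g i k) (fun w => all w (arc t g i k)).
Proof. by move=> w w' ww'; apply: eq_in_all. Qed.

Lemma determined_joined t g k : (k <= period t)%N ->
  determined (arc t g 0 (period t)) (joined t g k).
Proof.
move=> kd w w' ww'; rewrite /joined; congr (_ || _); apply: eq_in_all => e ea;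
  apply: ww'; case/mapP: ea => j; rewrite mem_iota => jk ->;
  by apply/map_f; rewrite mem_iota; lia.
Qed.

Lemma determined_survives j t g : determined (support j t g) (survives j t g).
Proof.
elim: j t g => //= j IH t g w w' ww'; apply: eq_in_has => k kt.
congr (_ && _).
  apply: determined_joined; first by move: kt; rewrite mem_steps => /andP[_ /ltnW].
  by move=> e ea; apply: ww'; rewrite mem_cat ea.
apply: IH => e es; apply: ww'; rewrite mem_cat; apply/orP; right.
by apply/flattenP; exists (support j (~~ t) (g * gen t ^+ k)%g) => //; exact: map_f.
Qed.

(** The edges hanging from the identity on the side of factor [t]. The second case is the one edge
    of this type based at the identity, whose word is empty. *)
Definition in_branch t (e : edge X) : bool :=
  starts t e.1 || (e == edge_at t 1%g).

Lemma starts_gen t k h : (0 < k < period t)%N -> ~~ starts t h ->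
  starts t (gen t ^+ k * h)%g.
Proof.
by move=> kd th; rewrite /starts gen_mul_word // /letter_power; case: t {kd th}.
Qed.

Lemma starts_negb t h : starts (~~ t) h -> ~~ starts t h.
Proof. by rewrite /starts; case: (fp_word h) => [|[c|c] u] //; case: t. Qed.

Lemma in_branch_negb t e : in_branch (~~ t) e -> ~~ starts t e.1.
Proof. by case/orP=> [/starts_negb//|/eqP ->]. Qed.

Lemma arc_branch t e : e \in arc t 1%g 0 (period t) -> in_branch t e.
Proof.
case/mapP => -[|i]; rewrite mem_iota => id ->; rewrite /in_branch mul1g.
  by rewrite expg0 eqxx orbT.
by rewrite -[(_ ^+ _)%g]mulg1 starts_gen.
Qed.

Lemma support_branch j t e : e \in support j t 1%g -> in_branch t e.
Proof.
elim: j t e => //= j IH t e; rewrite mem_cat => /orP[/arc_branch//|].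
case/flattenP=> s /mapP[k]; rewrite mem_steps => kd ->.
rewrite mul1g -[(_ ^+ _)%g]mulg1 support_mul => /mapP[e' /IH /in_branch_negb e't ->].
by apply/orP; left; exact: starts_gen.
Qed.

(** The first letter separates branches with different [k]. The clause on [e.2] concerns edges based
    at [gen t ^+ k] itself, a vertex shared with the cycle of type [t], where only the label tells
    branch from cycle. *)
Lemma support_word j t k e : (0 < k < period t)%N ->
  e \in support j (~~ t) (gen t ^+ k)%g ->
  exists2 u, fp_word e.1 = letter_power t k :: u &
    u = [::] -> e.2 = (edge_at (~~ t) 1%g).2.
Proof.
move=> kd; rewrite -[(_ ^+ _)%g]mulg1 support_mul => /mapP[e' /support_branch be' ->].
exists (fp_word e'.1); first by apply: gen_mul_word => //; exact: in_branch_negb.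
move=> e'1; case/orP: be' => [|/eqP -> //].
by rewrite /starts e'1.
Qed.

Lemma arc_support_disjoint j t k : (0 < k < period t)%N ->
  {in arc t 1%g 0 (period t), forall e, e \notin support j (~~ t) (gen t ^+ k)%g}.
Proof.
move=> kd e /mapP[i]; rewrite mem_iota mul1g => id ->.
apply/negP => /(support_word kd)[u].
case: i id => [|i] id; first by [].
(* The word has a single letter, so the labels must agree: [gen t = gen (~~ t)], which the factor of
   the first letter excludes. *)
rewrite -[(_ ^+ _)%g]mulg1 gen_mul_word // => -[_ <-] /(_ erefl) /(congr1 val) /= tt'.
have d1 : (0 < 1 < period t)%N by lia.
have : starts t (gen t) by rewrite -[gen t]mulg1 -[X in (X * _)%g]expg1 starts_gen.
rewrite tt' /starts /gen.
by case: t {kd id tt' d1} => /=; rewrite /prepend /=; case: ifP.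
Qed.

Lemma support_disjoint i j t k l : (0 < k < period t)%N -> (0 < l < period t)%N ->
  k != l -> {in support i (~~ t) (gen t ^+ k)%g,
    forall e, e \notin support j (~~ t) (gen t ^+ l)%g}.
Proof.
move=> kd ld kl e /(support_word kd)[u eu _]; apply/negP.
case/(support_word ld) => v; rewrite eu => -[klE _] _.
move/eqP: kl; apply; apply: letter_power_inj klE.
  by case/andP: kd.
by case/andP: ld.
Qed.

(** * Recursive bounds on survival probabilities *)

Section SurvivalProbability.
Context (R : realType) (p : R) (P : probability (config X) R).
Hypotheses (p01 : 0 <= p <= 1) (bP : is_bernoulli_percolation p P).

(* Expected number of further vertices in the open cluster of a vertex of a
   cycle of length [d]. *)
Definition excess (p : R) (d : nat) : R :=
  \sum_(k <- iota 1 d.-1) (p ^+ k + p ^+ (d - k) - p ^+ d).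

Definition survival j t : R := prob P (survives j t 1%g).

Lemma prob_survives j t g : prob P (survives j t g) = survival j t.
Proof.
have dA := @determined_survives j t 1%g.
rewrite /survival -(prob_map bP (@translate_inj g) dA).
congr prob; apply/funext => w; rewrite -survives_mul mulg1 //.
Qed.

Lemma uniq_arc t g : uniq (arc t g 0 (period t)).
Proof.
rewrite map_inj_in_uniq ?iota_uniq // => i j; rewrite !mem_iota => id jd.
move=> /(congr1 fst)/= /mulgI /(congr1 (@fp_word _ _)).
case: i j id jd => [|i] [|j] id jd //.
- by rewrite -[(_ ^+ j.+1)%g]mulg1 gen_mul_word.
- by rewrite -[(_ ^+ i.+1)%g]mulg1 gen_mul_word.
- rewrite -[(_ ^+ i.+1)%g]mulg1 -[(_ ^+ j.+1)%g]mulg1 !gen_mul_word //.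
  by move=> [] /letter_power_inj; apply.
Qed.

(** Inclusion-exclusion for the two complementary arcs: both are open exactly when the whole cycle
    is. *)
Lemma prob_joined t k : (0 < k < period t)%N ->
  prob P (joined t 1%g k) = p ^+ k + p ^+ (period t - k) - p ^+ (period t).
Proof.
case/andP=> k0 kd; have ud := uniq_arc t 1%g.
have cat_arc : arc t 1%g 0 k ++ arc t 1%g k (period t - k) = arc t 1%g 0 (period t).
  by rewrite -map_cat -iotaD subnKC // ltnW.
have := ud; rewrite -cat_arc cat_uniq => /and3P[u1 _ u2].
rewrite (@prob_or _ _ _ P bP (arc t 1%g 0 (period t))); first last.
- apply: determined_sub (@determined_arc _ _ _ _) => e.
  by rewrite -cat_arc mem_cat orbC => ->.
- apply: determined_sub (@determined_arc _ _ _ _) => e.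
  by rewrite -cat_arc mem_cat => ->.
rewrite !(prob_all_open bP) // !size_map !size_iota; congr (_ - _).
transitivity (prob P (fun w => all w (arc t 1%g 0 (period t)))).
  by congr prob; apply/funext => w; rewrite -cat_arc all_cat.
by rewrite (prob_all_open bP) // size_map size_iota.
Qed.

(** The factor [1] is kept to match the unfolding of [survives] at the identity. *)
Let branch j t k w := joined t 1%g k w && survives j (~~ t) (1 * gen t ^+ k)%g w.

Let determined_branch j t k : k \in steps t ->
  determined (support j.+1 t 1%g) (branch j t k).
Proof.
move=> kt; apply: determined_and.
  apply: determined_sub (@determined_joined _ _ _ _) => [e|].
    by rewrite /= mem_cat => ->.
  by move: kt; rewrite mem_steps => /andP[_ /ltnW].
apply: determined_sub (@determined_survives _ _ _) => e es.
rewrite /= mem_cat; apply/orP; right.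
by apply/flattenP; eexists; [exact: map_f kt|].
Qed.

Let prob_branch j t k : k \in steps t ->
  prob P (branch j t k) =
  (p ^+ k + p ^+ (period t - k) - p ^+ period t) * survival j (~~ t).
Proof.
rewrite mem_steps => kd; rewrite -prob_joined //.
rewrite -(prob_survives j (~~ t) (1 * gen t ^+ k)%g).
rewrite (prob_indep bP (@determined_joined _ _ _ _) (@determined_survives _ _ _)) //.
  by case/andP: kd => _ /ltnW.
by rewrite mul1g; exact: arc_support_disjoint.
Qed.

Lemma survival_ge0 j t : 0 <= survival j t.
Proof. exact: prob_ge0. Qed.

Lemma excess_ge0 d : 0 <= excess p d.
Proof.
have /andP[p0 p1] := p01.
rewrite /excess big_seq; apply: sumr_ge0 => k; rewrite mem_iota => kd.
have -> : p ^+ k + p ^+ (d - k) - p ^+ d = p ^+ k + p ^+ (d - k) * (1 - p ^+ k).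
  by rewrite mulrBr mulr1 -exprD subnK ?addrA //; lia.
by rewrite addr_ge0 ?exprn_ge0 // mulr_ge0 ?exprn_ge0 // subr_ge0 exprn_ile1.
Qed.

Lemma survival_le_excess j t :
  survival j.+1 t <= excess p (period t) * survival j (~~ t).
Proof.
rewrite /excess mulr_suml; apply: le_trans (prob_has bP p01 _) _.
  by move=> k; exact: determined_branch.
by rewrite le_eqVlt; apply/orP; left; apply/eqP/eq_big_seq => k; exact: prob_branch.
Qed.

(** Bonferroni over the vertices of the cycle. In the pair terms the [joined] events are dropped;
    two distinct branches are independent, and there are at most [period t ^ 2] pairs. *)
Lemma survival_ge_excess j t :
  excess p (period t) * survival j (~~ t) -
    (period t)%:R ^+ 2 * survival j (~~ t) ^+ 2 <= survival j.+1 t.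
Proof.
apply: le_trans (prob_has_ge bP p01 (iota_uniq _ _) (@determined_branch j t)).
apply: lerB.
  rewrite /excess mulr_suml le_eqVlt; apply/orP; left; apply/eqP/eq_big_seq => k kt.
  exact/esym/prob_branch.
have sq0 : 0 <= survival j (~~ t) ^+ 2 by rewrite exprn_ge0 // survival_ge0.
have dk : ((period t).-1%:R : R) <= (period t)%:R by rewrite ler_nat leq_pred.
apply: (@le_trans _ _ (\sum_(k <- steps t) \sum_(l <- steps t) survival j (~~ t) ^+ 2)).
  rewrite big_seq [leRHS]big_seq; apply: ler_sum => k kt.
  rewrite [leRHS](bigID (fun l => l != k)) /= -[leLHS]addr0.
  apply: lerD; last by rewrite sumr_ge0.
  rewrite big_seq_cond [leRHS]big_seq_cond; apply: ler_sum => l /andP[lt lk].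
  have dk' := @determined_survives j (~~ t) (1 * gen t ^+ k)%g.
  have dl' := @determined_survives j (~~ t) (1 * gen t ^+ l)%g.
  have -> : survival j (~~ t) ^+ 2 = prob P (fun w =>
      survives j (~~ t) (1 * gen t ^+ k)%g w && survives j (~~ t) (1 * gen t ^+ l)%g w).
    rewrite (prob_indep bP dk' dl') ?prob_survives ?expr2 // !mul1g.
    by apply: support_disjoint; rewrite -?mem_steps // eq_sym.
  apply: (prob_le bP p01 (s := support j.+1 t 1%g)).
  - by apply: determined_and; exact: determined_branch.
  - have sub i : i \in steps t ->
        {subset support j (~~ t) (1 * gen t ^+ i)%g <= support j.+1 t 1%g}.
      move=> it e es; rewrite /= mem_cat; apply/orP; right.
      by apply/flattenP; eexists; [exact: map_f it|].
    apply: determined_and; [exact: determined_sub (sub k kt) dk'|].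
    exact: determined_sub (sub l lt) dl'.
  - by move=> w /andP[/andP[_ ->] /andP[_ ->]].
rewrite !big_const_seq !count_predT size_iota !iter_addr_0 -mulrnA.
rewrite -[leLHS]mulr_natl natrM; apply: ler_wpM2r => //.
by rewrite expr2; apply: ler_pM.
Qed.

(** Only the neighbour [k = 1] is kept, which is joined with probability at least [p]. This serves
    when survival is not small and the quadratic loss of [survival_ge_excess] is too large. *)
Lemma survival_ge_step j t : (1 < period t)%N ->
  p * survival j (~~ t) <= survival j.+1 t.
Proof.
move=> d1; have /andP[p0 p1] := p01.
have kt : 1%N \in steps t by rewrite mem_steps.
apply: (@le_trans _ _ (prob P (branch j t 1))).
  rewrite prob_branch // ler_wpM2r ?survival_ge0 // -addrA lerDl subr_ge0.
  by apply: ler_wiXn2l => //; exact: leq_subr.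
apply: (prob_le bP p01 (determined_branch kt) (@determined_survives _ _ _)).
by move=> w bw /=; apply/hasP; exists 1%N.
Qed.

Lemma survival0 t : survival 0 t = 1.
Proof. exact: (prob_true bP). Qed.

Lemma survival_subcritical j t :
  survival (j.*2) t <= (excess p (period t) * excess p (period (~~ t))) ^+ j.
Proof.
elim: j => [|j IH]; first by rewrite survival0 expr0.
rewrite doubleS exprS -mulrA; apply: le_trans (survival_le_excess _ _) _.
rewrite ler_wpM2l ?excess_ge0 //; apply: le_trans (survival_le_excess _ _) _.
by rewrite negbK ler_wpM2l ?excess_ge0.
Qed.

Lemma survival_supercritical t : 0 < p ->
  (1 < period t)%N -> (1 < period (~~ t))%N ->
  1 < excess p (period t) * excess p (period (~~ t)) ->
  exists2 c, 0 < c & forall j, c <= survival (j.*2) t.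
Proof.
move=> p0 d1 d2; have := excess_ge0 (period t); have := excess_ge0 (period (~~ t)).
set f1 := excess p (period t); set f2 := excess p (period (~~ t)) => f20 f10 F1.
pose N1 := (period t)%:R ^+ 2 : R; pose N2 := (period (~~ t))%:R ^+ 2 : R.
have N10 : 0 <= N1 by rewrite exprn_ge0.
have N20 : 0 <= N2 by rewrite exprn_ge0.
(* [f1 * N2 + N1 * f2 ^+ 2] is the coefficient of the loss in [x ^+ 2] over two generations; adding
   1 makes [K] positive. *)
pose K := f1 * N2 + N1 * f2 ^+ 2 + 1.
have K0 : 0 < K by rewrite ltr_wpDl // addr_ge0 ?mulr_ge0 ?exprn_ge0.
pose delta := (f1 * f2 - 1) / K.
have delta0 : 0 < delta by rewrite divr_gt0 // subr_gt0.
(* With [x] the probability of surviving [2j] generations, the next one [z]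
   satisfies [z >= x * (f1 * f2 - K * x)], hence [z >= x] for [x <= delta], and
   [z >= p ^+ 2 * x] always. *)
exists (Num.min 1 (p ^+ 2 * delta)).
  by rewrite lt_min ltr01 mulr_gt0 ?exprn_gt0.
elim=> [|j IH]; first by rewrite survival0 ge_min lexx.
rewrite doubleS; set z := survival _ _; set x := survival _ _ in IH.
pose y := survival (j.*2).+1 (~~ t).
have x0 : 0 <= x := survival_ge0 _ _.
have y0 : 0 <= y := survival_ge0 _ _.
case: (leP x delta) => xd; last first.
  have yx : p * x <= y by have := survival_ge_step (j.*2) d2; rewrite negbK.
  have zy : p * y <= z := survival_ge_step _ d1.
  rewrite ge_min; apply/orP; right; apply: le_trans zy.
  rewrite expr2 -mulrA ler_wpM2l ?(ltW p0) //; apply: le_trans yx.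
  by rewrite ler_wpM2l ?(ltW p0) // ltW.
apply: le_trans IH _.
have yl : f2 * x - N2 * x ^+ 2 <= y.
  by have := survival_ge_excess (j.*2) (~~ t); rewrite negbK.
have yu : y <= f2 * x by have := survival_le_excess (j.*2) (~~ t); rewrite negbK.
have zl : f1 * y - N1 * y ^+ 2 <= z := survival_ge_excess _ t.
have xK : x * K <= f1 * f2 - 1 by rewrite -ler_pdivlMr.
apply: le_trans zl.
have h1 : f1 * (f2 * x - N2 * x ^+ 2) <= f1 * y by apply: ler_wpM2l.
have h2 : N1 * y ^+ 2 <= N1 * (f2 * x) ^+ 2.
  by apply: ler_wpM2l => //; rewrite lerXn2r // nnegrE mulr_ge0.
have h3 : x * (x * K) <= x * (f1 * f2 - 1) by apply: ler_wpM2l.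
rewrite /K in h3; move: h1 h2 h3 (sqr_ge0 x); rewrite !expr2; nra.
Qed.

End SurvivalProbability.

(** * The open cluster of the identity in terms of survival *)

Section Cluster.
Variable w : config X.
Hypotheses (a1 : a != 1%g) (b1 : b != 1%g).

Lemma period_gt1 t : (1 < period t)%N.
Proof. by rewrite /period; case: t; rewrite order_gt1. Qed.

Lemma cluster_trans x y z :
  Defs.cluster w x y -> Defs.cluster w y z -> Defs.cluster w x z.
Proof.
move=> [q xq <-] [q' yq' <-]; exists (q ++ q'); first by rewrite cat_path xq.
by rewrite last_cat.
Qed.

Lemma cluster_step t g : w (edge_at t g) ->
  Defs.cluster w g (g * gen t)%g /\ Defs.cluster w (g * gen t)%g g.
Proof.
move=> we; split.
  exists [:: (g * gen t)%g : vertex X] => //=; rewrite andbT.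
  by apply/asboolP; exists (edge_at t g); split=> //; left.
exists [:: g : vertex X] => //=; rewrite andbT.
by apply/asboolP; exists (edge_at t g); split=> //; right.
Qed.

Lemma cluster_arc t g i k : all w (arc t g i k) ->
  Defs.cluster w (g * gen t ^+ i)%g (g * gen t ^+ (i + k))%g /\
  Defs.cluster w (g * gen t ^+ (i + k))%g (g * gen t ^+ i)%g.
Proof.
elim: k i => [|k IH] i /=; first by rewrite addn0; split; exists [::].
case/andP=> /cluster_step [c1 c2] /IH; rewrite addSnnS expgSr mulgA => -[c3 c4].
by split; [exact: cluster_trans c1 c3 | exact: cluster_trans c4 c2].
Qed.

Lemma cluster_joined t g k : (k <= period t)%N -> joined t g k w ->
  Defs.cluster w g (g * gen t ^+ k)%g.
Proof.
move=> kd /orP[] /cluster_arc [c1 c2].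
  by move: c1; rewrite add0n expg0 mulg1.
(* The second arc runs from [g * gen t ^+ k] on to [g * gen t ^+ period t = g] and is walked
   backwards. *)
by move: c2; rewrite subnKC // gen_period mulg1.
Qed.

(** [ks] is an explicit witness of survival: the exponents of the reduced word leading from [g] to
    the endpoint. *)
Fixpoint chain t g ks : bool :=
  if ks is k :: ks' then
    [&& k \in steps t, joined t g k w & chain (~~ t) (g * gen t ^+ k)%g ks']
  else true.

Fixpoint endpoint t g ks : G :=
  if ks is k :: ks' then endpoint (~~ t) (g * gen t ^+ k)%g ks' else g.

Lemma chain_rcons t g ks k : chain t g (rcons ks k) =
  [&& chain t g ks, k \in steps (t (+) odd (size ks)) &
      joined (t (+) odd (size ks)) (endpoint t g ks) k w].
Proof.
elim: ks t g => [|l ks IH] t g /=; first by rewrite addbF andbT.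
by rewrite IH /= -!andbA addNb addbN.
Qed.

Lemma endpoint_rcons t g ks k : endpoint t g (rcons ks k) =
  (endpoint t g ks * gen (t (+) odd (size ks)) ^+ k)%g.
Proof.
elim: ks t g => [|l ks IH] t g /=; first by rewrite addbF.
by rewrite IH addNb addbN.
Qed.

Lemma chain_survives t g ks j : chain t g ks -> (j <= size ks)%N ->
  survives j t g w.
Proof.
elim: j t g ks => // j IH t g [|k ks] //= /and3P[kt gk ch] js.
by apply/hasP; exists k => //; rewrite gk (IH _ _ ks).
Qed.

Lemma survives_chain j t g : survives j t g w ->
  exists2 ks, size ks = j & chain t g ks.
Proof.
elim: j t g => [|j IH] t g /=; first by exists [::].
case/hasP=> k kt /andP[gk /IH[ks sks ch]].
by exists (k :: ks); rewrite /= ?sks // kt gk.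
Qed.

Lemma chain_cluster t g ks : chain t g ks -> Defs.cluster w g (endpoint t g ks).
Proof.
elim: ks t g => [|k ks IH] t g /=; first by exists [::].
case/and3P=> kt gk /IH; apply: cluster_trans; apply: cluster_joined => //.
by move: kt; rewrite mem_steps => /andP[_ /ltnW].
Qed.

Lemma endpoint_mul t g h ks : endpoint t (g * h)%g ks = (g * endpoint t h ks)%g.
Proof. by elim: ks t h => //= k ks IH t h; rewrite -mulgA IH. Qed.

(** The second part carries the induction: it lets the next letter be put in front without
    cancellation. *)
Lemma size_endpoint t g ks : chain t g ks ->
  size (fp_word (endpoint t 1%g ks)) = size ks /\
  ~~ starts (~~ t) (endpoint t 1%g ks).
Proof.
elim: ks t g => [|k ks IH] t g //= /and3P[kt _ /IH]; rewrite negbK => -[<- st].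
rewrite mem_steps in kt.
rewrite mul1g -[(_ ^+ _)%g]mulg1 endpoint_mul gen_mul_word //; split=> //.
by apply: starts_negb; rewrite negbK starts_gen.
Qed.

Definition reached h : Prop := exists t ks, chain t 1%g ks /\ h = endpoint t 1%g ks.

Lemma joinedS t g k : (k < period t)%N -> joined t g k w ->
  w (edge_at t (g * gen t ^+ k)%g) -> joined t g k.+1 w.
Proof.
move=> kd gk wk; case/orP: gk => gk; apply/orP; [left|right].
  by rewrite -addn1 /arc iotaD map_cat all_cat gk /= add0n wk.
by move: gk; rewrite -subnSK //= => /andP[].
Qed.

Lemma joined_pred t g k : (k < period t)%N -> joined t g k.+1 w ->
  w (edge_at t (g * gen t ^+ k)%g) -> joined t g k w.
Proof.
move=> kd gk wk; case/orP: gk => gk; apply/orP; [left|right].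
  by move: gk; rewrite -addn1 /arc iotaD map_cat all_cat => /andP[].
by rewrite -subnSK //= wk.
Qed.

(** The extreme values [k = 0] and [k = period s] both return to the entrance of the cycle; any
    other [k] appends a step. *)
Lemma reached_rcons t ks k : chain t 1%g ks ->
  let s := t (+) odd (size ks) in
  (k <= period s)%N -> joined s (endpoint t 1%g ks) k w ->
  reached (endpoint t 1%g ks * gen s ^+ k)%g.
Proof.
move=> ch s kd jk; exists t.
case: (posnP k) => [->|k0]; first by exists ks; rewrite expg0 mulg1.
move: kd; rewrite leq_eqVlt => /orP[/eqP ->|kd].
  by exists ks; rewrite gen_period mulg1.
exists (rcons ks k); rewrite chain_rcons endpoint_rcons ch mem_steps k0 kd.
by split.
Qed.

(* For each of the two cycles through a reached vertex, the vertex is reached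
   from the entrance of that cycle, possibly with [k = 0]. *)
Lemma reached_view h s : reached h -> exists t ks k,
  [/\ chain t 1%g ks, s = t (+) odd (size ks), (k < period s)%N,
      joined s (endpoint t 1%g ks) k w & h = (endpoint t 1%g ks * gen s ^+ k)%g].
Proof.
have d1 := period_gt1.
case=> t [ks [ch ->]].
have j0 u g : joined u g 0 w by [].
case: (eqVneq s (t (+) odd (size ks))) => [->|ns].
  by exists t, ks, 0%N; rewrite expg0 mulg1; split=> //; exact: ltnW (d1 _).
case/lastP: ks ch ns => [|ks k].
  by move=> _ _; exists s, [::], 0%N; rewrite /= addbF expg0 mulg1; split=> //;
    exact: ltnW (d1 _).
rewrite chain_rcons endpoint_rcons size_rcons /= addbN => /and3P[ch kt jk] ns.
have -> : s = t (+) odd (size ks) by case: (s) (t (+) _) ns => -[].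
by exists t, ks, k; split=> //; move: kt; rewrite mem_steps => /andP[].
Qed.

Lemma reached_edge h s : w (edge_at s h) -> reached h <-> reached (h * gen s)%g.
Proof.
move=> wh; split.
  case/(reached_view s)=> t [ks [k [ch st kd jk hE]]].
  rewrite hE -mulgA -expgSr st; apply: reached_rcons => //; rewrite -st //.
  by apply: joinedS => //; rewrite -hE.
case/(reached_view s)=> t [ks [k [ch st kd jk hE]]].
have {hE}hE : h = (endpoint t 1%g ks * gen s ^+ k * (gen s)^-1)%g by rewrite -hE mulgK.
case: k kd jk hE => [|k] kd jk hE; last first.
  have {}hE : h = (endpoint t 1%g ks * gen s ^+ k)%g by rewrite hE expgSr mulgA mulgK.
  rewrite hE st; apply: reached_rcons; rewrite -?st //; first exact: ltnW (ltnW kd).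
  by apply: joined_pred => //; [exact: ltnW|rewrite -hE].
(* Position 0 wraps round: [h] is the last vertex of the cycle, and the single edge from it back to
   the entrance is the second arc. *)
have d0 : (period s).-1.+1 = period s by apply: prednK.
have {}hE : h = (endpoint t 1%g ks * gen s ^+ (period s).-1)%g.
  rewrite hE expg0 mulg1; congr (_ * _)%g; apply: (mulIg (gen s)).
  by rewrite mulVg -expgSr d0 gen_period.
rewrite hE st; apply: reached_rcons; rewrite -?st ?leq_pred //.
have d01 : (period s - (period s).-1 = 1)%N by rewrite -[X in (X - _)%N]d0 subSnn.
apply/orP; right; rewrite d01.
by rewrite /= -hE wh.
Qed.

(** An open path may backtrack and wander within cycles, so it is not turned into a chain directly:
    [reached] is shown to be preserved along each open edge. *)
Lemma cluster_reached h : Defs.cluster w 1%g h <-> reached h.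
Proof.
split=> [[q]|[t [ks [ch ->]]]]; last exact: chain_cluster ch.
have : reached 1%g by exists true, [::].
elim: q (1%g : G) => [|y q IH] x rx /= => [_ <- //|/andP[/asboolP xy yq]].
apply: IH yq; case: xy => e [we]; have [s es] := edge_atE e.
rewrite es /= in we *.
by case=> -[xE yE]; move: rx; rewrite -xE -yE => /(reached_edge we).
Qed.

Lemma finite_size_lt j : finite_set [set g : G | (size (fp_word g) < j)%N].
Proof.
(* Bounded sequences over a finite alphabet form a finite type; non-reduced ones are sent to the
   identity. *)
apply: (@sub_finite_set _ _ ((fun u : j.-bseq (G1 + G2)%type =>
  odflt (1%g : G) (insub (u : seq _))) @` setT)).
  move=> g /= /ltnW gj; exists (Bseq gj) => //=.
  by rewrite -[X in insub X]/(val g) valK.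
exact/finite_image/finite_finset.
Qed.

(** Finitely many words have bounded length, so an infinite cluster contains arbitrarily long words;
    conversely a chain of [j] steps ends at a word of length [j]. *)
Lemma infinite_clusterP : infinite_set (Defs.cluster w (1%g : G)) <->
  forall j, survives j true 1%g w || survives j false 1%g w.
Proof.
split=> [inf j|surv fin].
  apply/negP => /negP; rewrite negb_or => /andP[nt nf]; apply: inf.
  apply: sub_finite_set (finite_size_lt j) => h /cluster_reached[t [ks [ch ->]]] /=.
  have [-> _] := size_endpoint ch; rewrite ltnNge; apply/negP => jk.
  have := chain_survives ch jk; by case: (t); apply/negP.
have [M HM] : exists M, forall h, Defs.cluster w (1%g : G) h -> (size (fp_word h) < M)%N.
  move: fin => /finite_fsetP[D DE].
  exists (\max_(h <- D) size (fp_word (h : G))).+1 => h.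
  rewrite DE /= => hD; rewrite ltnS.
  by apply: leq_bigmax_seq.
have [t] : exists t, survives M t 1%g w.
  by case/orP: (surv M) => sM; [exists true|exists false].
case/survives_chain=> ks sks ch.
have := HM _ (chain_cluster ch); have [-> _] := size_endpoint ch.
by rewrite sks ltnn.
Qed.

End Cluster.

(** * From survival to the percolation probability *)

Section PhaseTransition.
Import numFieldNormedType.Exports.
Context (R : realType) (p : R) (P : probability (config X) R).
Hypotheses (a1 : a != 1%g) (b1 : b != 1%g).
Hypotheses (p01 : 0 <= p <= 1) (bP : is_bernoulli_percolation p P).

Let survives_any j (w : edge X -> bool) : bool :=
  survives j true 1%g w || survives j false 1%g w.

Let supp j := support j true 1%g ++ support j false 1%g.

Let determined_true j : determined (supp j) (survives j true 1%g).
Proof.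
by apply: determined_sub (@determined_survives _ _ _) => e; rewrite mem_cat => ->.
Qed.

Let determined_false j : determined (supp j) (survives j false 1%g).
Proof.
by apply: determined_sub (@determined_survives _ _ _) => e; rewrite mem_cat orbC => ->.
Qed.

Let survives_anyP j : measurable [set w : config X | survives_any j w] /\
  P [set w : config X | survives_any j w] = (prob P (survives_any j))%:E.
Proof.
have su : {subset supp j <= undup (supp j)} by move=> e; rewrite mem_undup.
have dA : determined (supp j) (survives_any j).
  move=> w w' ww'; rewrite /survives_any.
  by rewrite (@determined_true j w w') // (@determined_false j w w').
by have [] := probP bP (fun=> true) (undup_uniq _) (determined_sub su dA).
Qed.

(** This expresses a non-local event through local ones, giving its measurability and access to
    continuity of the measure. *)
Let infinite_cluster_bigcap :
  [set w : config X | infinite_set (Defs.cluster w (1%g : G))] =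
  \bigcap_j [set w : config X | survives_any j w].
Proof.
apply/seteqP; split => w /=; first by move=> /(infinite_clusterP w a1 b1) H j _; exact: H.
by move=> H; apply/(infinite_clusterP w a1 b1) => j; exact: (H j I).
Qed.

Let measurable_infinite_cluster :
  measurable [set w : config X | infinite_set (Defs.cluster w (1%g : G))].
Proof.
rewrite infinite_cluster_bigcap; apply: bigcapT_measurable => j.
by have [] := survives_anyP j.
Qed.

Lemma theta_subcritical : excess p #[a]%g * excess p #[b]%g < 1 ->
  @theta R X (1%g : G) P = 0%E.
Proof.
set F := _ * _ => F1; have F0 : 0 <= F by rewrite mulr_ge0 ?excess_ge0.
have bound j : (@theta R X (1%g : G) P <= (2 * F ^+ j)%:E)%E.
  have [mU PU] := survives_anyP j.*2.
  apply: le_trans (_ : P [set w : config X | survives_any j.*2 w] <= _)%E.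
    apply: le_measure; rewrite ?inE //.
    by rewrite infinite_cluster_bigcap => w /(_ j.*2 I).
  rewrite PU lee_fin (prob_or bP (@determined_true _) (@determined_false _)).
  apply: le_trans (_ : survival P j.*2 true + survival P j.*2 false <= _).
    by rewrite gerBl prob_ge0.
  rewrite mulr_natl mulr2n; apply: lerD.
    by have := survival_subcritical p01 bP j true; rewrite mulrC.
  exact: (survival_subcritical p01 bP j false).
apply/eqP; rewrite eq_le measure_ge0 andbT.
have fin : @theta R X (1%g : G) P \is a fin_num by exact: fin_num_measure.
rewrite -(fineK fin) lee_fin.
have cv : geometric 2 F @ \oo --> (0 : R) by apply: cvg_geometric; rewrite ger0_norm.
rewrite -(cvg_lim (@Rhausdorff R) cv); apply: limr_ge; first by apply/cvg_ex; exists 0.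
by apply: nearW => j; rewrite -lee_fin fineK //; exact: bound.
Qed.

Lemma theta_supercritical : 0 < p -> 1 < excess p #[a]%g * excess p #[b]%g ->
  (0 < @theta R X (1%g : G) P)%E.
Proof.
move=> p0 F1.
have [c c0 cs] : exists2 c, 0 < c & forall j, c <= survival P j.*2 false.
  by apply: (survival_supercritical p01 bP p0) => //; exact: period_gt1.
pose U j := [set w : config X | survives_any j w].
have mU j : measurable (U j) by have [] := survives_anyP j.
have Umono i j : (i <= j)%N -> U j `<=` U i.
  move=> ij w /= /orP[] /survives_chain[ks sks ch]; apply/orP; [left|right];
  by apply: chain_survives ch _; rewrite sks.
have cU j : (c%:E <= P (U j))%E.
  (* The bound [c] is known for even generations only; monotonicity extends it to all. *)
  have jj : (j <= j.*2)%N by rewrite -addnn leq_addr.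
  apply: (@le_trans _ _ (P (U j.*2))); last first.
    by apply: le_measure; rewrite ?inE //; exact: Umono.
  have [_ ->] := survives_anyP j.*2; rewrite lee_fin; apply: le_trans (cs j) _.
  have su : {subset supp j.*2 <= undup (supp j.*2)} by move=> e; rewrite mem_undup.
  apply: (prob_le bP p01 (@determined_false _)).
    move=> w w' ww'; rewrite /survives_any.
    by rewrite (@determined_true _ w w') // (@determined_false _ w w').
  by move=> w sw; rewrite /survives_any sw orbT.
have cv : (P \o U) @ \oo --> P (\bigcap_j U j).
  apply: nonincreasing_cvg_mu => //.
  - by rewrite -ge0_fin_numE //; exact: (fin_num_measure P _ (mU 0%N)).
  - exact: bigcapT_measurable.
  - by move=> i j ij; apply/subsetPset; exact: Umono.
rewrite /theta infinite_cluster_bigcap; apply: (@lt_le_trans _ _ c%:E) => //.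
rewrite -(cvg_lim _ cv) //; apply: lime_ge; first by apply/cvg_ex; eexists; exact: cv.
by apply: nearW => j; exact: cU.
Qed.

End PhaseTransition.

End FreeProductPercolation.

(** * The mean offspring *)

Section Excess.
Context (R : realType).
Implicit Types (p : R) (d : nat).

(** Both power sums are the same geometric sum, read in opposite orders; the factor [1 - p] clears
    its denominator. *)
Lemma excessE p d : (0 < d)%N ->
  (1 - p) * excess p d = 2 * (p - p ^+ d) - d.-1%:R * ((1 - p) * p ^+ d).
Proof.
case: d => // d _; rewrite /excess /=.
have gs : (1 - p) * \sum_(k <- iota 1 d) p ^+ k = p - p ^+ d.+1.
  elim: d => [|d IH]; first by rewrite big_nil mulr0 expr1 subrr.
  rewrite -[X in iota 1 X]addn1 iotaD big_cat mulrDr IH /= big_seq1 add1n !exprS; ring.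
have gr : \sum_(k <- iota 1 d) p ^+ (d.+1 - k) = \sum_(k <- iota 1 d) p ^+ k.
  have -> : iota 1 d = index_iota 1 d.+1 by rewrite /index_iota subn1.
  rewrite [RHS]big_nat_rev; apply: eq_big_nat => k kd.
  by congr (_ ^+ _); lia.
rewrite sumrB big_split /= gr mulrBr mulrDr gs big_const_seq count_predT size_iota.
rewrite iter_addr_0 -mulr_natl; ring.
Qed.

Lemma excess2 p : excess p 2 = 2 * p - p ^+ 2.
Proof. by rewrite /excess /= big_seq1 expr1; ring. Qed.

(** By [excessE] the claim is [3 * p - 1 < p ^+ d * (2 + d.-1 * (1 - p))]. Below [1/3] the left side
    is negative; above, it is at most [3^-1 ^+ d <= p ^+ d]. The margin beyond [1/3] later makes the
    bound on the infimum strict. *)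
Lemma excess_lt1 p d : (2 <= d)%N -> 0 <= p <= 3^-1 + 3^-1 ^+ d.+1 ->
  excess p d < 1.
Proof.
move=> d2 /andP[p0 pd].
have i3 : (0 : R) <= 3^-1 by lra.
have p1 : p <= 2 / 3.
  apply: le_trans pd _; suff : (3^-1 : R) ^+ d.+1 <= 3^-1 by lra.
  by rewrite ler_iXnr //; lra.
have pX0 : 0 <= p ^+ d by rewrite exprn_ge0.
have d1 : (0 : R) <= d.-1%:R by [].
have key : 3 * p - 1 < p ^+ d * (2 + d.-1%:R * (1 - p)).
  have le2 : p ^+ d * 2 <= p ^+ d * (2 + d.-1%:R * (1 - p)).
    by rewrite ler_wpM2l // lerDl mulr_ge0 //; lra.
  apply: lt_le_trans le2; case: (ltP p 3^-1) => p3; first by lra.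
  have : (3^-1 : R) ^+ d <= p ^+ d by rewrite lerXn2r // nnegrE.
  have : (0 : R) < 3^-1 ^+ d by rewrite exprn_gt0 //; lra.
  by move: pd; rewrite exprS; lra.
have pp : 0 < 1 - p by lra.
rewrite -(ltr_pM2l pp) mulr1 excessE; last by lia.
by move: key; set x := p ^+ d; set y := _.-1%:R; nra.
Qed.

Lemma pow_3_7_lt1 d : (3 <= d)%N ->
  (3 / 7 : R) ^+ d * (d%:R ^+ 2 + d%:R - 1) < 1.
Proof.
elim: d => // d IH; rewrite leq_eqVlt => /orP[/eqP <-|].
  by rewrite /= !exprS expr0; lra.
rewrite ltnS => d3; have {IH} := IH d3.
have x0 : (0 : R) < (3 / 7) ^+ d by rewrite exprn_gt0 //; lra.
have D3 : (3 : R) <= d%:R by rewrite (ler_nat _ 3).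
rewrite -[d.+1%:R]natr1 [_ ^+ d.+1]exprS => IH.
set D := d%:R in D3 IH *; set x := _ ^+ d in x0 IH *.
apply: le_lt_trans IH; rewrite [_ * x]mulrC -mulrA ler_wpM2l ?(ltW x0) //.
nra.
Qed.

(** For [p >= d / (3 * d - 2)] one has [3 * p - 1 >= 2 / (3 * d - 2)] and
    [1 - p <= 2 * (d - 1) / (3 * d - 2)], so [p ^+ d * (d ^+ 2 + d - 1) < 1] suffices. The cap [3/7]
    is the value of [d / (3 * d - 2)] at [d = 3]. *)
Lemma excess_gt1 p d : (3 <= d)%N -> 0 < p <= 3 / 7 ->
  d%:R <= p * (3 * d%:R - 2) -> 1 < excess p d.
Proof.
move=> d3 /andP[p0 p37] pd.
have D3 : (3 : R) <= d%:R by rewrite (ler_nat _ 3).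
have pp : 0 < 1 - p by lra.
rewrite -(ltr_pM2l pp) mulr1 excessE; last by lia.
have xle : p ^+ d <= (3 / 7) ^+ d by rewrite lerXn2r // nnegrE; lra.
have x0 : 0 <= p ^+ d by rewrite exprn_ge0 // ltW.
have := pow_3_7_lt1 d3.
have -> : d.-1%:R = d%:R - 1 :> R.
  by rewrite -[in RHS](@prednK d) -?natr1 ?addrK //; lia.
set D := d%:R in pd D3 *; set x := p ^+ d in xle x0 *; set y := _ ^+ d in xle * => yD.
have xD : x * (D ^+ 2 + D - 1) < 1.
  by apply: le_lt_trans yD; rewrite ler_wpM2r //; nra.
have D2 : 0 < 3 * D - 2 by lra.
have h1 : x * ((3 * D - 2) * (2 + (D - 1) * (1 - p))) <= x * (2 * (D ^+ 2 + D - 1)).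
  by rewrite ler_wpM2l //; nra.
have h2 : (3 * D - 2) * (x * (2 + (D - 1) * (1 - p))) < (3 * D - 2) * (3 * p - 1).
  nra.
by move: h2; rewrite ltr_pM2l // => h2; nra.
Qed.

(** At [p = 1/2] the excess equals [2 - (d + 3) / 2 ^ d]. The threshold [4/3] compensates
    [excess 2^-1 2 = 3/4]. *)
Lemma excess_half_gt d : (4 <= d)%N -> 4 / 3 < excess (2^-1 : R) d.
Proof.
move=> d4.
have h : (d%:R + 3) * (2^-1 : R) ^+ d < 2 / 3.
  elim: d d4 => // d IH; rewrite leq_eqVlt => /orP[/eqP <-|].
    by rewrite /= !exprS expr0; lra.
  rewrite ltnS => d4; have {IH} := IH d4.
  have D3 : (4 : R) <= d%:R by rewrite (ler_nat _ 4).
  have x0 : (0 : R) < 2^-1 ^+ d by rewrite exprn_gt0 //; lra.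
  by rewrite -[d.+1%:R]natr1 exprS; move: x0; set x := _ ^+ d; nra.
have pp : (0 : R) < 1 - 2^-1 by lra.
rewrite -(ltr_pM2l pp) excessE; last by lia.
have -> : d.-1%:R = d%:R - 1 :> R.
  by rewrite -[in RHS](@prednK d) -?natr1 ?addrK //; lia.
by move: h; set x := _ ^+ d; lra.
Qed.

(** For [m >= 3] both factors exceed 1 at [m / (3 * m - 2)], since [d / (3 * d - 2)] decreases in
    [d]. For [m = 2] the first factor is below 1 and the second has to compensate. *)
Lemma exists_supercritical m n : (2 <= m)%N -> (m <= n)%N -> (2 < n)%N ->
  exists p, [/\ 0 < p, p <= 1,
    p < 1 / (2 * (1 - n%:R / (1 + m%:R * (n%:R - 1))) + 1) &
    1 < excess p m * excess p n].
Proof.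
move=> m2 mn n3.
have M2 : (2 : R) <= m%:R by rewrite (ler_nat _ 2).
have MN : (m%:R : R) <= n%:R by rewrite ler_nat.
pose q : R := 1 + m%:R * (n%:R - 1).
have q0 : 0 < q by rewrite /q; nra.
have hq : n%:R / q <= 1 by rewrite ler_pdivrMr // /q; nra.
case: (leqP 3 m) => m3.
  have M3 : (3 : R) <= m%:R by rewrite (ler_nat _ 3).
  have d0 : (0 : R) < 3 * m%:R - 2 by lra.
  (* [1 / (h + 1)] for the slightly larger value [h = 2 - 2 / m] *)
  pose p : R := m%:R / (3 * m%:R - 2).
  have p0 : 0 < p by rewrite divr_gt0 //; lra.
  have p37 : p <= 3 / 7 by rewrite ler_pdivrMr //; lra.
  have pm : p * (3 * m%:R - 2) = m%:R by rewrite divfK // gt_eqF.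
  exists p; split => //; first by lra.
    rewrite ltr_pdivlMr; last by lra.
    rewrite -(ltr_pM2r d0) mulrAC pm mul1r -/q.
    have : 1 < m%:R * (n%:R / q) by rewrite mulrA ltr_pdivlMr // /q; nra.
    by nra.
  have f1 : 1 < excess p m by apply: excess_gt1; rewrite ?p0 ?pm.
  have f2 : 1 < excess p n.
    by apply: excess_gt1; rewrite ?p0 //; nra.
  by apply: mulr_egt1.
have mE : m = 2%N by lia.
subst m.
case: (leqP 4 n) => n4.
  have N4 : (4 : R) <= n%:R by rewrite (ler_nat _ 4).
  (* Again [m / (3 * m - 2)], now with [m = 2]. *)
  exists 2^-1; split; try lra.
    rewrite ltr_pdivlMr -/q; last by lra.
    have : 1 < 2 * (n%:R / q) by rewrite mulrA ltr_pdivlMr // /q; nra.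
    by lra.
  by rewrite excess2; have := excess_half_gt n4; rewrite expr2; lra.
have -> : n = 3%N by lia.
(* For orders 2 and 3 the product at [1/2] is only [15/16]; [11/20] is just below the upper bound
   [5/9]. *)
exists (11 / 20); split; try lra.
  by rewrite (_ : 1 + _ * _ = 5) ?ltr_pdivlMr; lra.
by rewrite excess2 /excess /= big_cons big_seq1 /= !exprS expr0; lra.
Qed.

End Excess.

(** * The Cheeger constant *)

Section Cheeger.
Context (R : realType).

Lemma cheeger_ge0 (X : multigraph) (o : vertex X) : 0 <= cheeger R X.
Proof.
apply: lb_le_inf.
  exists (#|` fset_set (edge_boundary [fset o]%fset)|%:R / #|` [fset o]%fset|%:R).
  by exists [fset o]%fset => //=; apply/fset0Pn; exists o; rewrite inE.
by move=> _ [K _ <-]; rewrite divr_ge0.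
Qed.

(* No boundary edge of [K] is labelled [x], and as many edges labelled [y] enter
   [K] as leave it, at most [#|K| - #|L|]. *)
Lemma cheeger_le (G : groupType) (x y : G) (K L : {fset G}) :
  (forall g, (g * x \in K)%g = (g \in K)) ->
  L != fset0 -> {subset L <= K} -> {in L, forall g, (g * y \in K)%g} ->
  cheeger R (cayley [fset x; y]%fset) <= 2 * (1 - #|` L|%:R / #|` K|%:R).
Proof.
move=> Kx L0 LK LyK; set X := cayley _.
have LK' : (L `<=` K)%fset by apply/fsubsetP.
have K0 : K != fset0 by apply: contra_neq L0 => K0; apply/eqP; rewrite -fsubset0 -K0.
have yS : y \in [fset x; y]%fset by rewrite !inE eqxx orbT.
pose ey g : edge X := (g, [` yS]%fset).
pose Ly := [fset (g * y)%g | g in L]%fset.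
have LyK' : (Ly `<=` K)%fset by apply/fsubsetP => _ /imfsetP[g gL ->]; exact: LyK.
have cLy : #|` Ly| = #|` L| by rewrite card_imfset //; exact: mulIg.
(* [B1] covers the edges labelled [y] that leave [K], [B2] those that enter it, each indexed by its
   endpoint in [K]. *)
pose B1 := [fset ey g | g in (K `\` L)%fset]%fset.
pose B2 := [fset ey (g * y^-1)%g | g in (K `\` Ly)%fset]%fset.
have card_B : (#|` fset_set (edge_boundary (X := X) K)| <= (#|` K| - #|` L|).*2)%N.
  apply: leq_trans (_ : #|` (B1 `|` B2)%fset| <= _)%N; last first.
    apply: leq_trans (leq_card_fsetU _ _) _; rewrite -addnn; apply: leq_add.
      by apply: leq_trans (leq_imfset_card _ _ _) _; rewrite -cardfsDS.
    by apply: leq_trans (leq_imfset_card _ _ _) _; rewrite -cLy -cardfsDS.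
  apply: fsubset_leq_card; apply/fsubsetP => e.
  rewrite in_fset_set; last exact: (@cayley_edge_boundary_finite G [fset x; y]%fset K).
  rewrite inE /edge_boundary /=; case: e => g [s sS] /=.
  have := sS; rewrite !inE => /orP[] /eqP sE; rewrite {1}sE.
    by rewrite Kx addbb.
  have -> : (g, FSetSub sS) = ey g by congr pair; apply/val_inj.
  case gK: (g \in K) => /= gyK; apply/orP; [left|right]; apply/imfsetP.
    exists g => //=; rewrite inE gK andbT; apply/negP => /LyK.
    by rewrite (negPf gyK).
  exists (g * y)%g; rewrite ?mulgK //= inE gyK andbT.
  apply/imfsetP => -[h hL /mulIg gh].
  by move: gK; rewrite gh (LK _ hL).
have cK0 : (0 : R) < #|` K|%:R by rewrite ltr0n cardfs_gt0.
have cLK : (#|` L| <= #|` K|)%N by exact: fsubset_leq_card.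
apply: (@le_trans _ _ (#|` fset_set (edge_boundary (X := X) K)|%:R / #|` K|%:R)).
  apply: ge_inf; last by exists K.
  by exists 0 => _ [K' _ <-]; rewrite divr_ge0.
rewrite ler_pdivrMr // -mulrA mulrBl mul1r divfK ?gt_eqF // -natrB //.
by rewrite -natrM ler_nat mul2n.
Qed.

(** Apply [cheeger_le] to [K = f(G1) g(G2) f(G1)], stable under [f x], and [L = f(G1) g(G2)], stable
    under [g y]. The target [G] and the maps are abstract so that either factor can play the outer
    role. *)
Lemma cheeger_le_factors (G : groupType) (G1 G2 : finGroupType)
    (f : G1 -> G) (g : G2 -> G) (x : G1) (y : G2) :
  {morph f : u v / (u * v)%g} -> {morph g : u v / (u * v)%g} ->
  injective (fun u : G1 * G2 => f u.1 * g u.2)%g ->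
  cheeger R (cayley [fset f x; g y]%fset) <=
  2 * (1 - #|G2|%:R / (1 + #|G1|%:R * (#|G2|%:R - 1))).
Proof.
move=> fM gM inj.
have f1 : f 1%g = 1%g by apply: (mulgI (f 1%g)); rewrite -fM !mulg1.
have g1 : g 1%g = 1%g by apply: (mulgI (g 1%g)); rewrite -gM !mulg1.
pose L : {fset G} := [fset v in [seq (f u.1 * g u.2)%g | u <- enum {: G1 * G2}]]%fset.
pose K : {fset G} := [fset v in [seq (f u.1.1 * g u.1.2 * f u.2)%g |
  u <- enum {: G1 * G2 * G1}]]%fset.
have inL u v : (f u * g v)%g \in L.
  by rewrite inE; apply/mapP; exists (u, v); rewrite ?mem_enum.
have inK u v t : (f u * g v * f t)%g \in K.
  by rewrite inE; apply/mapP; exists (u, v, t); rewrite ?mem_enum.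
have KP h : h \in K -> exists u v t, h = (f u * g v * f t)%g.
  by rewrite inE => /mapP[[[u v] t] _ ->]; exists u, v, t.
have LP h : h \in L -> exists u v, h = (f u * g v)%g.
  by rewrite inE => /mapP[[u v] _ ->]; exists u, v.
have L_K h : h \in L -> h \in K.
  by case/LP => u [v ->]; rewrite -[X in X \in _]mulg1 -f1.
have cL : #|` L| = (#|G1| * #|G2|)%N.
  have uL : uniq [seq (f u.1 * g u.2)%g | u <- enum {: G1 * G2}].
    by rewrite map_inj_uniq ?enum_uniq.
  by rewrite card_fseq (undup_id uL) size_map -cardE card_prod.
(* The products with middle factor 1 collapse to the elements of [f(G1)]. *)
have cK : (#|` K| <= #|G1| * (1 + #|G1| * #|G2|.-1))%N.
  pose s := [seq f u | u <- enum G1] ++ [seq (f u.1.1 * g u.1.2 * f u.2)%g |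
    u <- [seq (v, t) | v <- [seq (t, v) | t <- enum G1, v <- enum (predC1 (1%g : G2))],
          t <- enum G1]].
  have Ks : (K `<=` [fset v in s])%fset.
    apply/fsubsetP => _ /KP[u [v [t ->]]]; rewrite inE; apply/orP.
    case: (eqVneq v 1%g) => [->|v1]; [left|right]; rewrite inE.
      by rewrite g1 mulg1 -fM; apply/map_f; rewrite mem_enum.
    apply/mapP; exists (u, v, t) => //; apply: allpairs_f; last by rewrite mem_enum.
    by apply: allpairs_f; rewrite mem_enum.
  apply: leq_trans (fsubset_leq_card Ks) _; rewrite card_fseq.
  apply: leq_trans (size_undup _) _.
  rewrite size_cat !size_map !size_allpairs -!cardE cardC1 -enumT -cardT.
  by rewrite mulnDr muln1 mulnAC mulnA.
have gt1 : (0 < #|G1|)%N by apply/card_gt0P; exists 1%g.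
have gt2 : (0 < #|G2|)%N by apply/card_gt0P; exists 1%g.
have L0 : L != fset0 by rewrite -cardfs_gt0 cL muln_gt0 gt1 gt2.
apply: le_trans (_ : 2 * (1 - #|` L|%:R / #|` K|%:R) <= _).
  apply: cheeger_le => //.
    move=> h; apply/idP/idP => /KP[u [v [t hE]]].
      suff -> : h = (f u * g v * f (t * x^-1))%g by [].
      by apply: (mulIg (f x)); rewrite hE -[RHS]mulgA -fM mulgKV.
    by rewrite hE -mulgA -fM.
  by move=> h /LP[u [v ->]]; rewrite -mulgA -gM; apply: L_K.
have cK0 : (0 < #|` K|)%N.
  by rewrite cardfs_gt0; apply/fset0Pn; exists (f 1%g * g 1%g * f 1%g)%g; exact: inK.
rewrite ler_pM2l // lerD2l lerN2 cL natrM.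
have n1 : (1 : R) <= #|G2|%:R by rewrite (ler_nat _ 1).
have m0 : (0 : R) < #|G1|%:R by rewrite ltr0n.
have n0 : (0 : R) < #|` K|%:R by rewrite ltr0n.
have q0 : (0 : R) < 1 + #|G1|%:R * (#|G2|%:R - 1) by nra.
rewrite ler_pdivlMr // mulrAC ler_pdivrMr //.
have : (#|` K|%:R : R) <= #|G1|%:R * (1 + #|G1|%:R * (#|G2|%:R - 1)).
  apply: le_trans (_ : (#|G1| * (1 + #|G1| * #|G2|.-1))%:R <= _).
    by rewrite ler_nat.
  by rewrite !(natrM, natrD) -subn1 natrB.
move=> /(ler_wpM2l (ler0n _ #|G2|)); lra.
Qed.

End Cheeger.

(** * Independence of the two factors, and the conclusion *)

Lemma fp_inl_inr (G1 G2 : groupType) (x : G1) (y : G2) :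
  fp_inl x = fp_inr y -> x = 1%g /\ y = 1%g.
Proof.
move/(congr1 (@fp_word _ _)); rewrite /= /prepend /=.
by case: eqP => [->|//]; case: eqP.
Qed.

Lemma generator_order (m : nat) (a : 'Z_m) :
  (2 <= m)%N -> generator [set: 'Z_m] a -> #[a]%g = m.
Proof. by move=> hm /eqP ga; rewrite orderE -ga cardsT card_ord Zp_cast. Qed.

Section FactorsInjective.
Variables (G1 G2 : finGroupType).
Let G := free_product G1 G2.

Lemma fp_inl_inr_inj : injective (fun u : G1 * G2 => fp_inl u.1 * fp_inr u.2 : G)%g.
Proof.
move=> [x y] [x' y'] /= E.
have /fp_inl_inr[] : fp_inl (x'^-1 * x)%g = fp_inr (y' * y^-1)%g :> G.
  apply: (mulIg (fp_inr y)); rewrite -fp_inrM mulgKV fp_inlM -mulgA E mulgA -fp_inlM.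
  by rewrite mulVg fp_inl1 mul1g.
move=> /(canRL (mulKVg _)) -> /(canRL (mulgKV _)) ->.
by rewrite mulg1 mul1g.
Qed.

Lemma fp_inr_inl_inj : injective (fun u : G2 * G1 => fp_inr u.1 * fp_inl u.2 : G)%g.
Proof.
move=> [y x] [y' x'] /= E.
have /esym/fp_inl_inr[] : fp_inr (y'^-1 * y)%g = fp_inl (x' * x^-1)%g :> G.
  apply: (mulIg (fp_inl x)); rewrite -fp_inlM mulgKV fp_inrM -mulgA E mulgA -fp_inrM.
  by rewrite mulVg fp_inr1 mul1g.
move=> /(canRL (mulgKV _)) -> /(canRL (mulKVg _)) ->.
by rewrite mulg1 mul1g.
Qed.

End FactorsInjective.

Theorem proposition13 (R : realType) (m n : nat)
    (hm : (2 <= m)%N) (hn : (2 <= n)%N) (hmn : (1 < (m - 1) * (n - 1))%N)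
    (a : 'Z_m) (b : 'Z_n)
    (ha : generator [set: 'Z_m] a) (hb : generator [set: 'Z_n] b) :
  let G := free_product 'Z_m 'Z_n in
  let X := cayley [fset (fp_inl a : G); (fp_inr b : G)]%fset in
  forall P : R -> probability (config X) R,
    (forall p, 0 <= p <= 1 -> is_bernoulli_percolation p (P p)) ->
    1 / 3 < critical_probability X (1%g : G) P < 1 / (cheeger R X + 1).
Proof.
move=> G X P bP.
have oa := generator_order hm ha; have ob := generator_order hn hb.
have a1 : a != 1%g by rewrite -order_gt1 oa.
have b1 : b != 1%g by rewrite -order_gt1 ob.
have cm : #|'Z_m| = m by rewrite card_ord Zp_cast.
have cn : #|'Z_n| = n by rewrite card_ord Zp_cast.
have h0 : 0 <= cheeger R X by exact: (@cheeger_ge0 R X (1%g : G)).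
have [p [p0 p1 ph F1]] : exists p : R, [/\ 0 < p, p <= 1,
    p < 1 / (cheeger R X + 1) & 1 < excess p m * excess p n].
  (* Since [1 / (h + 1)] decreases in [h], an upper bound on the Cheeger constant suffices. *)
  have below (p h : R) : p < 1 / (h + 1) -> cheeger R X <= h -> p < 1 / (cheeger R X + 1).
    move=> ph Xh; apply: lt_le_trans ph _; rewrite !div1r lef_pV2 ?posrE ?lerD2r //.
      by apply: ltr_pwDr => //; exact: le_trans h0 Xh.
    exact: ltr_pwDr.
  have [mn|/ltnW nm] := leqP m n.
    have [|p [p0 p1 ph F1]] := exists_supercritical R hm mn; first by nia.
    exists p; split=> //; apply: below ph _; rewrite -cm -cn.
    by apply: cheeger_le_factors; [exact: fp_inlM|exact: fp_inrM|exact: fp_inl_inr_inj].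
  (* The larger order is now [m]: the factors exchange roles. *)
  have [|p [p0 p1 ph F1]] := exists_supercritical R hn nm; first by nia.
  exists p; split=> //; last by rewrite mulrC.
  apply: below ph _; rewrite -cm -cn /X fsetUC.
  by apply: cheeger_le_factors; [exact: fp_inrM|exact: fp_inlM|exact: fp_inr_inl_inj].
have p01 : 0 <= p <= 1 by rewrite ltW.
have Sp : 0 <= p <= 1 /\ (0 < @theta R X (1%g : G) (P p))%E.
  split=> //; apply: theta_supercritical p01 (bP _ p01) p0 _ => //.
  by rewrite oa ob.
apply/andP; split; last first.
  apply: le_lt_trans ph; apply: ge_inf => //.
  by exists 0 => q [/andP[]].
(* The larger order has the smaller margin in [excess_lt1], so below [q0] both factors are
   subcritical. *)
pose q0 : R := 3^-1 + 3^-1 ^+ (maxn m n).+1.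
apply: (@lt_le_trans _ _ q0).
  by rewrite div1r ltrDl exprn_gt0 // invr_gt0.
(* The supercritical [p] shows that the infimum is over a non-empty set and so not a default
   value. *)
apply: lb_le_inf; first by exists p.
move=> q [q01 tq]; rewrite leNgt; apply/negP => qq0.
have /andP[q_ge0 q_le1] := q01.
have small d : (2 <= d)%N -> (d <= maxn m n)%N -> excess q d < 1.
  move=> d2 dmn; apply: excess_lt1 => //; rewrite q_ge0 /=.
  apply: le_trans (ltW qq0) _; rewrite lerD2l; apply: ler_wiXn2l => //; lra.
move: tq; rewrite (theta_subcritical a1 b1 q01 (bP _ q01)) ?ltxx // oa ob.
by apply: mulr_ilt1; rewrite ?excess_ge0 // small // ?leq_maxl ?leq_maxr.
Qed.
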